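(* Let $\mu$ be a classification problem, let $f^*$ be its Bayes regressor and $r^*_a:=f^*\sharp(\mu^X_a\times\{a\})$ for $a\in[m]$. Then the minimum of $\sum_{a\in[m]}\mathrm{Err}_a(h)$ over all randomized classifiers $h:\mathcal X\times\mathcal A\to\mathcal Y$ satisfying demographic parity exists and $$\min_{h:\ \text{DP holds}}\ \sum_{a\in[m]}\mathrm{Err}_a(h)=\frac12\min_{q\in\mathcal Q_k}\sum_{a\in[m]}W_1(r^*_a,q)=\frac12\min_{q\in\mathcal Q_k}\sum_{a\in[m]}\ \min_{\gamma_a\in\Gamma(r^*_a,q)}\int_{\Delta_k\times\mathcal Y}\|s-y\|_1\,d\gamma_a(s,y).$$
   Context: Setup. $\mathcal X$ is a standard Borel space, $k\ge 2$, $\mathcal Y=\{e_1,\dots,e_k\}\subset\mathbb R^k$ is the set of standard basis vectors (one-hot labels), and $\mathcal A=[m]=\{1,\dots,m\}$. A classification problem is a probability distribution $\mu$ of a triple $(X,Y,A)$ on $\mathcal X\times\mathcal Y\times\mathcal A$ with $\mathbb P(A=a)>0$ for every $a$; $\mu_a$ is $\mu$ conditioned on $A=a$ and $\mu^X_a$ is the law of $X$ under $\mu_a$. A randomized function $f:\mathcal U\to\mathcal V$ is given by a Markov kernel $K$ with $\mathbb P(f(u)\in B)=K(u,B)$; its internal randomness is independent of $(X,Y,A)$. The push-forward of a measure $p$ is $f\sharp p(B)=\int K(u,B)\,dp(u)$. A (randomized) classifier is a randomized function $h:\mathcal X\times\mathcal A\to\mathcal Y$, and $\mathrm{Err}_a(h):=\mathbb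 P(h(X,a)\neq Y\mid A=a)$, the probability being over $\mu$ and the randomness of $h$. $h$ satisfies demographic parity (DP) if $\mathbb P(h(X,a)=y\mid A=a)=\mathbb P(h(X,a')=y\mid A=a')$ for all $y\in\mathcal Y$, $a,a'\in\mathcal A$. $\Delta_k=\{x\in\mathbb R^k:x\ge0,\ \sum_i x_i=1\}$. The Bayes regressor is $f^*(x,a)=\mathbb E_\mu[Y\mid X=x,A=a]\in\Delta_k$ (the vector of conditional class probabilities), and $f^*\sharp(\mu^X_a\times\{a\})$ is the law of $f^*(X,a)$ for $X\sim\mu^X_a$. $\mathcal Q_k$ is the set of probability distributions supported on $\mathcal Y$. $\Gamma(p,q)$ is the set of couplings of $p$ and $q$, and $W_1(p,q)=\inf_{\gamma\in\Gamma(p,q)}\int\|s-s'\|_1\,d\gamma(s,s')$ is the Wasserstein-1 distance w.r.t. the $\ell_1$ metric on $\mathbb R^k$. *)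

(* Defs.v *)
From HB Require Import structures.
From mathcomp Require Import all_boot all_order all_algebra.
From mathcomp Require Import all_classical all_reals all_analysis.
Set Implicit Arguments. Unset Strict Implicit. Unset Printing Implicit Defensive.
Import Order.TTheory GRing.Theory Num.Theory.
Local Open Scope classical_set_scope.
Local Open Scope ring_scope.

(* R^k is modelled by [k.-tuple R] with the product (Borel) sigma-algebra;
   [A = [m] = {1,...,m}] is modelled inside [nat] (discrete sigma-algebra);
   the sample space of (X, Y, A) is [X * k.-tuple R * nat]. *)

Section defs.
Context (R : realType).

(** Standard Borel space: Borel-isomorphic to a Borel subset of the reals
    (Kuratowski's characterization of standard Borel spaces). *)
Definition standard_borel d (X : measurableType d) : Prop :=
  exists phi : X -> R,
    [/\ injective phi, measurable_fun setT phi, measurable (range phi)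
      & forall A : set X, measurable A -> measurable (phi @` A)].

Context (k m : nat).

Definition onehot (i : 'I_k) : k.-tuple R := [tuple (i == j)%:R | j < k].
Definition Yset : set (k.-tuple R) := [set y | exists i, y = onehot i].
Definition Aset : set nat := [set a | (1 <= a <= m)%N].

Definition l1dist (s t : k.-tuple R) : R := \sum_(i < k) `|tnth s i - tnth t i|.

Context d (X : measurableType d).
Local Notation Omega := (X * k.-tuple R * nat)%type.

Definition classification_problem (mu : probability Omega R) : Prop :=
  mu (setT `*` Yset `*` Aset) = 1%E /\
  forall a, Aset a -> (0 < mu [set z : Omega | z.2 = a])%E.

Definition probA (mu : probability Omega R) (a : nat) : \bar R :=
  mu [set z : Omega | z.2 = a].

(** f is (a version of) the Bayes regressor E[Y | X, A]: measurable in (x,a),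
    integrable, and satisfying the defining property of the conditional
    expectation w.r.t. sigma(X, A). *)
Definition bayes_regressor (mu : probability Omega R)
    (f : X -> nat -> k.-tuple R) : Prop :=
  measurable_fun setT (fun u : (X * nat)%type => f u.1 u.2) /\
  forall i : 'I_k,
    mu.-integrable setT (fun z : Omega => (tnth (f z.1.1 z.2) i)%:E) /\
    forall B : set (X * nat)%type, measurable B ->
      (\int[mu]_(z in [set z : Omega | B (z.1.1, z.2)]) (tnth z.1.2 i)%:E =
       \int[mu]_(z in [set z : Omega | B (z.1.1, z.2)])
          (tnth (f z.1.1 z.2) i)%:E)%E.

Definition rstar (mu : probability Omega R) (f : X -> nat -> k.-tuple R)
    (a : nat) : set (k.-tuple R) -> \bar R :=
  fun B => (mu [set z : Omega | z.2 = a /\ B (f z.1.1 a)]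
            * ((fine (probA mu a))^-1)%:E)%E.

Definition classifier (h : R.-pker (X * nat)%type ~> k.-tuple R) : Prop :=
  forall u, h u Yset = 1%E.

Definition prob_pred (mu : probability Omega R)
    (h : R.-pker (X * nat)%type ~> k.-tuple R) (a : nat) (y : k.-tuple R)
    : \bar R :=
  ((\int[mu]_(z in [set z : Omega | z.2 = a]) h (z.1.1, a) [set y])
   * ((fine (probA mu a))^-1)%:E)%E.

Definition Err (mu : probability Omega R)
    (h : R.-pker (X * nat)%type ~> k.-tuple R) (a : nat) : \bar R :=
  ((\int[mu]_(z in [set z : Omega | z.2 = a])
       h (z.1.1, a) [set y | y <> z.1.2])
   * ((fine (probA mu a))^-1)%:E)%E.

Definition sumErr (mu : probability Omega R)
    (h : R.-pker (X * nat)%type ~> k.-tuple R) : \bar R :=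
  (\sum_(1 <= a < m.+1) Err mu h a)%E.

Definition DP (mu : probability Omega R)
    (h : R.-pker (X * nat)%type ~> k.-tuple R) : Prop :=
  forall y, Yset y -> forall a a', Aset a -> Aset a' ->
    prob_pred mu h a y = prob_pred mu h a' y.

End defs.

Section transport.
Context (R : realType) (k : nat).

Definition in_Qk (q : probability (k.-tuple R) R) : Prop :=
  q (@Yset R k) = 1%E.

Definition coupling (p q : set (k.-tuple R) -> \bar R)
    (g : probability (k.-tuple R * k.-tuple R)%type R) : Prop :=
  forall B : set (k.-tuple R), measurable B ->
    g (B `*` setT) = p B /\ g (setT `*` B) = q B.

Definition transport_cost (g : probability (k.-tuple R * k.-tuple R)%type R)
  : \bar R := (\int[g]_z (l1dist z.1 z.2)%:E)%E.

Definition W1 (p q : set (k.-tuple R) -> \bar R) : \bar R :=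
  ereal_inf [set transport_cost g | g in [set g | coupling p q g]].

End transport.

(* Main.v *)
Require Import Defs.
From HB Require Import structures.
From mathcomp Require Import all_boot all_order all_algebra ring lra.
From mathcomp Require Import all_classical all_reals all_analysis measurable_realfun.
Set Implicit Arguments.
Unset Strict Implicit.
Unset Printing Implicit Defensive.
Import Order.TTheory GRing.Theory Num.Theory.
Import numFieldNormedType.Exports.
Local Open Scope classical_set_scope.
Local Open Scope ring_scope.
Local Open Scope ereal_scope.

(** A classifier is a family of weights [w_i(x, a)], its conditional probability
    of answering label [i]; since [|s - e_i|_1 = 2 (1 - s_i)] on the simplex and
    [P(Y <> e_i | X, A) = 1 - f_i(X, A)], its error on group [a] is half the cost
    [C_a(w) = E[sum_i w_i |f - e_i|_1 | A = a]].  The law of [(f(X, a), h(X, a))]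
    given [A = a] is a coupling of [r*_a] with the output law and has cost
    [C_a(w)]; conversely the Radon-Nikodym densities of [B |-> g(B x {e_i})] with
    respect to [r*_a] turn a coupling [g] into weights with the same cost.  Hence
    both minimization problems are linear programs over measurable weights.
    Their minima are attained without weak compactness: approximate minimizers
    chosen to have almost minimal L2 norm form, by the parallelogram identity, a
    sequence converging almost everywhere, and dominated convergence passes the
    constraints and the cost to the limit. *)

(** * Minimizing sequences *)

Section minimizing_sequence.
Local Open Scope ring_scope.
Context (R : realType) (V : Type).

(** A sequence minimizing [J] whose terms moreover have almost minimal [N]: with
    [N] a squared norm, the last bound controls consecutive differences. *)
Lemma minimizing_sequence (W : set V) (mid : V -> V -> V) (J N : V -> R) (b : R) :
    W !=set0 ->
    (forall v, W v -> [/\ 0 <= J v, 0 <= N v & N v <= b]) ->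
    (forall v w, W v -> W w -> W (mid v w) /\ J (mid v w) <= Num.max (J v) (J w)) ->
  exists v : nat -> V, forall j,
    [/\ W (v j), forall w, W w -> J (v j) <= J w + 2^-1 ^+ j &
        (N (v j) + N (v j.+1)) / 2 <= N (mid (v j) (v j.+1)) + 2 * 8^-1 ^+ j].
Proof.
move=> [v0 Wv0] bnd midW.
pose M := inf (J @` W).
have infJ : has_inf (J @` W).
  split; first by exists (J v0), v0.
  by exists 0 => _ [w /bnd[? _ _] <-].
have MJ w : W w -> M <= J w.
  by move=> Ww; apply: ge_inf; [exact: infJ.2 | exists w].
(* [S] collects the lower bounds of [N] on near-minimal level sets [J <= M + e], so its supremum [c]
   is the limit, as [e] tends to 0, of the infimum of [N] over these sets. *)
pose S := [set t | exists2 e : R, 0 < e &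
  forall w, W w -> J w <= M + e -> t <= N w].
have nearM (e : R) : 0 < e -> exists2 w, W w & J w <= M + e.
  move=> e0; have [_ [w Ww <-] /ltW we] := inf_adherent e0 infJ.
  by exists w.
have supS : has_sup S.
  split; first by exists 0, 1 => // w /bnd[].
  exists b => t [e e0 tN]; have [w Ww Jw] := nearM e e0.
  by apply: le_trans (tN w Ww Jw) _; have [] := bnd w Ww.
pose c := sup S.
pose Q j w := W w /\ exists2 e : R, 0 < e <= 2^-1 ^+ j &
  [/\ J w <= M + e, N w <= c + 8^-1 ^+ j &
      forall w', W w' -> J w' <= M + e -> c - 8^-1 ^+ j <= N w'].
have p8 j : (0 : R) < 8^-1 ^+ j by rewrite exprn_gt0.
have p2 j : (0 : R) < 2^-1 ^+ j by rewrite exprn_gt0.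
have /choice[v Qv] : forall j, exists w, Q j w.
  move=> j; have [t [e0 e00 tN] ct] := sup_adherent (p8 j) supS.
  pose e := Num.min e0 (2^-1 ^+ j).
  have e_gt0 : 0 < e by rewrite lt_min e00 p2.
  (* A number above [c] is a lower bound of [N] on no level set, so the level set of width [e]
     contains a point with [N] at most [c + 8^-1 ^+ j]. *)
  have : ~ S (c + 8^-1 ^+ j).
    move=> /(sup_ubound supS.2); rewrite -/c; have := p8 j; lra.
  move=> notS.
  have [w [Ww Jw Nw]] : exists w, [/\ W w, J w <= M + e & N w <= c + 8^-1 ^+ j].
    apply: contrapT => H; apply: notS; exists e => // w Ww Jw.
    by rewrite leNgt; apply/negP => /ltW lN; apply: H; exists w.
  exists w; split=> //; exists e; first by rewrite e_gt0 ge_min lexx orbT.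
  split=> // w' Ww' Jw'; apply: le_trans (tN _ Ww' _); first exact: ltW.
  by apply: (le_trans Jw'); rewrite lerD2l ge_min lexx.
exists v => j; have [Wj [e /andP[e0 e2] [Jj Nj lb]]] := Qv j.
have [Wj1 [e' /andP[e'0 e'2] [Jj1 Nj1 lb']]] := Qv j.+1.
have [Wm Jm] := midW _ _ Wj Wj1.
split=> //.
  by move=> w /MJ; lra.
have le8 : (8^-1 : R) ^+ j.+1 <= 8^-1 ^+ j.
  by rewrite exprS; have := p8 j; lra.
(* The midpoint lies in the wider of the two level sets, whose lower bound on [N] therefore applies
   to it. *)
have : c - 8^-1 ^+ j <= N (mid (v j) (v j.+1)).
  have [ee|/ltW ee] := leP e e'.
    apply: le_trans (lb' _ Wm _); first by lra.
    by apply: (le_trans Jm); rewrite ge_max Jj1 andbT; lra.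
  by apply: lb => //; apply: (le_trans Jm); rewrite ge_max Jj /=; lra.
lra.
Qed.

End minimizing_sequence.

(** * Almost everywhere convergence from summable L1 increments *)

Section ae_convergence.
Context d (T : measurableType d) (R : realType) (P : {measure set T -> \bar R}).

(** The sum of the absolute increments has an integral bounded by a geometric series, so it is
    finite almost everywhere; at such points the telescoping series of increments converges
    absolutely. *)
Lemma ae_cvg_geometric (u : nat -> T -> R) (C : R) :
    (forall j, measurable_fun setT (u j)) ->
    (forall j, \int[P]_x (`|u j.+1 x - u j x|)%:E <= (C * 2^-1 ^+ j)%:E) ->
  {ae P, forall x, cvgn (u ^~ x)}.
Proof.
move=> mu uC.
pose f n x : \bar R := (`|u n.+1 x - u n x|)%:E.
have mf n : measurable_fun setT (f n).
  by apply/measurable_EFinP; apply: measurableT_comp => //; exact: measurable_funB.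
have f0 n x : 0 <= f n x by rewrite lee_fin.
have intf : P.-integrable setT (fun x => \sum_(0 <= n <oo) f n x).
  apply/integrableP; split.
    by apply: ge0_emeasurable_sum.
  under eq_integral do rewrite gee0_abs ?nneseries_ge0//.
  rewrite integral_nneseries//.
  apply: (@le_lt_trans _ _ (\sum_(0 <= n <oo) (C * 2^-1 ^+ n)%:E)).
    apply: lee_nneseries => [n _ _|n _]; last exact: uC.
    by apply: integral_ge0.
  have -> : (fun n => \sum_(0 <= i < n) (C * 2^-1 ^+ i)%:E) =
      EFin \o series (geometric C 2^-1).
    by apply/funext => n; rewrite /= -sumEFin.
  rewrite EFin_lim ?ltry//.
  by apply: is_cvg_geometric_series; rewrite ger0_norm ?invf_lt1 ?ltr1n.
have := integrable_ae measurableT intf.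
apply: filterS => x /(_ I) fx.
have : cvgn (series (fun n => u n.+1 x - u n x)%R).
  apply: normed_cvg.
  apply: nondecreasing_is_cvgn.
    by apply: (@nondecreasing_series _ _ xpredT 0%N) => n _ _; exact: normr_ge0.
  exists (fine (\sum_(0 <= n <oo) f n x)) => _ [n _ <-].
  rewrite -lee_fin fineK// /series /= -sumEFin.
  exact: nneseries_lim_ge.
have E n : series (fun n => u n.+1 x - u n x)%R n = (u n x - u 0%N x)%R.
  by rewrite /series /= telescope_sumr.
move=> h; have -> : u ^~ x = (fun n => series (fun n => u n.+1 x - u n x)%R n + u 0%N x)%R.
  by apply/funext => n; rewrite E subrK.
by apply: is_cvgD => //; exact: is_cvg_cst.
Qed.

End ae_convergence.

(** * Linear programs over measurable weights *)

Section weights.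
Local Open Scope ring_scope.
Context d (T : measurableType d) (R : realType) (k : nat).
Implicit Types w v g : 'I_k -> T -> R.

(** [w i x] is the conditional probability of label [i] at the point [x]. *)
Definition weights w : Prop :=
  [/\ forall i, measurable_fun setT (w i), forall i x, 0 <= w i x &
      forall x, \sum_i w i x = 1].

Lemma weights_le1 w i x : weights w -> w i x <= 1.
Proof.
by move=> [_ w0 /(_ x) <-]; rewrite (bigD1 i)//= lerDl sumr_ge0.
Qed.

Definition midw v w : 'I_k -> T -> R := fun i x => (v i x + w i x) / 2.

Lemma weights_midw v w : weights v -> weights w -> weights (midw v w).
Proof.
move=> [mv v0 v1] [mw w0 w1]; split=> [i|i x|x].
- by apply: measurable_funM => //; exact: measurable_funD.
- by rewrite /midw divr_ge0// addr_ge0.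
- by rewrite /midw -mulr_suml big_split/= v1 w1; lra.
Qed.

Lemma measurable_mem (N : set T) : measurable N ->
  measurable_fun setT (fun x => x \in N).
Proof.
move=> mN; apply: (measurable_fun_bool true); rewrite setTI.
by rewrite (_ : _ @^-1` _ = N)//; apply/seteqP; split=> x /=; [exact: set_mem|exact: mem_set].
Qed.

Lemma cvg_sum_ord n (u : 'I_n -> nat -> R) (l : 'I_n -> R) :
  (forall i, u i @ \oo --> l i) ->
  (fun j => \sum_i u i j) @ \oo --> \sum_i l i.
Proof.
move=> ul; elim: (index_enum _) => [|i s ih].
  by rewrite big_nil; under eq_fun do rewrite big_nil; exact: cvg_cst.
by rewrite big_cons; under eq_fun do rewrite big_cons; exact: cvgD.
Qed.

Context (P : probability T R).

(** On a measurable null set containing the points of divergence the sequence is replaced by the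
    constant [v 0]. The limit then exists at every point, and so do the sign and sum conditions of
    [weights], which are not merely almost sure. *)
Lemma weights_lim (v : nat -> 'I_k -> T -> R) : (forall j, weights (v j)) ->
    (forall i, {ae P, forall x, cvgn (fun j => v j i x)}) ->
  exists2 w, weights w & {ae P, forall x, forall i, v ^~ i ^~ x @ \oo --> w i x}.
Proof.
move=> wv vc.
have [N [mN N0 subN]] : {ae P, forall x, forall i, cvgn (fun j => v j i x)}.
  exact: (filter_forall _ vc).
pose v' j i x := if x \in N then v 0%N i x else v j i x.
have cv' i x : cvgn (v' ^~ i ^~ x).
  rewrite /v'; have [xN|] := boolP (x \in N); first exact: is_cvg_cst.
  rewrite notin_setE => xN; apply: contrapT => nc; apply: xN.
  by apply: subN => /(_ i).
have wv' j : weights (v' j).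
  have [m0 p0 s0] := wv 0%N; have [mj pj sj] := wv j; rewrite /v'.
  split=> [i|i x|x]; last 2 first.
  - by case: (x \in N).
  - by case: (x \in N).
  - by apply: measurable_fun_ifT => //; exact: measurable_mem.
exists (fun i x => limn (v' ^~ i ^~ x)).
  split=> [i|i x|x].
  - apply: (@measurable_fun_cvg _ _ _ _ (fun j => v' j i)).
      by move=> j; have [] := wv' j.
    by move=> x _; exact: cv'.
  - apply: limr_ge => //; apply: nearW => j; by have [] := wv' j.
  - have h := cvg_sum_ord (fun i => cv' i x).
    apply: (cvg_unique _ h) => //=.
    under eq_fun => j do (have [_ _ ->] := wv' j).
    exact: cvg_cst.
exists N; split=> // x nc; apply: contrapT => xN; apply: nc => i /=.
have -> : v ^~ i ^~ x = v' ^~ i ^~ x.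
  by apply/funext => j; rewrite /v' memNset.
exact: cv'.
Qed.

Lemma Rintegral_probability_cst (r : R) : \int[P]_x r = r.
Proof.
rewrite Rintegral_cst// [X in _ * X](_ : _ = 1) ?mulr1//.
exact: (congr1 fine (probability_setT P)).
Qed.

(** Objectives and constraints of the linear programs below are all of this form. *)
Definition pairing g w := \int[P]_x (\sum_i w i x * g i x).

Definition integrables g := forall i, P.-integrable setT (EFin \o g i).

Lemma integrable_sumR (I : Type) (s : seq I) (g : I -> T -> R) :
  (forall i, P.-integrable setT (EFin \o g i)) ->
  P.-integrable setT (EFin \o (fun x => \sum_(i <- s) g i x)).
Proof.
move=> ig; rewrite (_ : _ \o _ = fun x => (\sum_(i <- s) (EFin \o g i) x)%E).
  exact: integrable_sum.
by apply/funext => x; rewrite /= sumEFin.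
Qed.

Lemma integrable_weight_mul w g i : weights w -> integrables g ->
  P.-integrable setT (EFin \o (fun x => w i x * g i x)).
Proof.
move=> ww ig; apply: le_integrable (ig i) => //.
  apply/measurable_EFinP; apply: measurable_funM; first by case: ww.
  exact/measurable_EFinP/(measurable_int _ (ig i)).
move=> x _ /=; rewrite lee_fin normrM ler_piMl//.
have [_ w0 _] := ww.
by rewrite ger0_norm//; exact: weights_le1.
Qed.

Lemma integrable_pairing w g : weights w -> integrables g ->
  P.-integrable setT (EFin \o (fun x => \sum_i w i x * g i x)).
Proof.
by move=> ww ig; apply: integrable_sumR => i; exact: integrable_weight_mul.
Qed.

Lemma integrables_weights w : weights w -> integrables w.
Proof.
move=> ww i; have [mw w0 _] := ww.
apply: (@le_integrable _ _ _ _ _ _ _ (EFin \o cst 1)) => //.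
- exact/measurable_EFinP.
- move=> x _ /=; rewrite lee_fin normr1 ger0_norm//; exact: weights_le1.
- exact: finite_measure_integrable_cst.
Qed.

Lemma integrableD_EFin (f g : T -> R) : P.-integrable setT (EFin \o f) ->
  P.-integrable setT (EFin \o g) ->
  P.-integrable setT (EFin \o (fun x => f x + g x)).
Proof. by move=> fi gi; exact: (integrableD _ fi gi). Qed.

Lemma integrableZ_EFin (r : R) (f : T -> R) : P.-integrable setT (EFin \o f) ->
  P.-integrable setT (EFin \o (fun x => r * f x)).
Proof. by move=> fi; exact: (integrableZl _ r fi). Qed.

Lemma pairing_midw v w g : weights v -> weights w -> integrables g ->
  pairing g (midw v w) = (pairing g v + pairing g w) / 2.
Proof.
move=> wv ww ig; rewrite /pairing -RintegralD//; try exact: integrable_pairing.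
rewrite -RintegralZr//; last by apply: integrableD_EFin; exact: integrable_pairing.
apply: eq_Rintegral => x _; rewrite -big_split/= mulr_suml.
by apply: eq_bigr => i _; rewrite /midw; ring.
Qed.

(** Written with products so that it is the pairing of [w] with itself. *)
Definition sqnorm w := \int[P]_x (\sum_i w i x * w i x).

Definition sqdist v w := \int[P]_x (\sum_i (v i x - w i x) ^+ 2).

Lemma integrable_sqnorm w : weights w ->
  P.-integrable setT (EFin \o (fun x => \sum_i w i x * w i x)).
Proof.
by move=> ww; apply: integrable_pairing => //; exact: integrables_weights.
Qed.

Let sqdistE v w x : \sum_i (v i x - w i x) ^+ 2 =
  2 * (\sum_i v i x * v i x) + 2 * (\sum_i w i x * w i x) +
  - 4 * (\sum_i midw v w i x * midw v w i x).
Proof.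
rewrite !mulr_sumr -!big_split/=; apply: eq_bigr => i _.
by rewrite /midw; field.
Qed.

Lemma integrable_sqdist v w : weights v -> weights w ->
  P.-integrable setT (EFin \o (fun x => \sum_i (v i x - w i x) ^+ 2)).
Proof.
move=> wv ww; under [X in EFin \o X]eq_fun do rewrite sqdistE.
by do 2 ?apply: integrableD_EFin; apply: integrableZ_EFin;
  apply: integrable_sqnorm => //; exact: weights_midw.
Qed.

(** The right-hand side is four times the gap controlled by [minimizing_sequence], whose consecutive
    terms are thus close in L2. *)
Lemma parallelogram v w : weights v -> weights w ->
  sqdist v w = 4 * ((sqnorm v + sqnorm w) / 2 - sqnorm (midw v w)).
Proof.
move=> wv ww; rewrite /sqdist; under eq_Rintegral do rewrite sqdistE.
have iZ r u : weights u ->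
    P.-integrable setT (EFin \o (fun x => r * \sum_i u i x * u i x)).
  by move=> wu; apply: integrableZ_EFin; exact: integrable_sqnorm.
have wm := weights_midw wv ww.
rewrite !RintegralD//; try exact: iZ; last by apply: integrableD_EFin; exact: iZ.
rewrite !RintegralZl//; try exact: integrable_sqnorm.
by rewrite /sqnorm; field.
Qed.

Lemma sqnorm_ge0 w : 0 <= sqnorm w.
Proof. by apply: Rintegral_ge0 => x _; apply: sumr_ge0 => i _; exact: sqr_ge0. Qed.

Lemma sqnorm_le1 w : weights w -> sqnorm w <= 1.
Proof.
move=> ww; have [_ w0 w1] := ww.
have -> : (1 : R) = \int[P]_x (cst 1 x).
  by rewrite Rintegral_probability_cst.
apply: le_Rintegral => //; first exact: integrable_sqnorm.
  exact: finite_measure_integrable_cst.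
move=> x _ /=; rewrite -(w1 x); apply: ler_sum => i _.
by rewrite ler_piMl//; exact: weights_le1.
Qed.

(** Dominated convergence: weights are at most 1, so the sum of the [|g i|] is an integrable
    bound. *)
Lemma pairing_cvg (v : nat -> 'I_k -> T -> R) w g :
    (forall j, weights (v j)) -> weights w -> integrables g ->
    {ae P, forall x, forall i, v ^~ i ^~ x @ \oo --> w i x} ->
  pairing g (v j) @[j --> \oo] --> pairing g w.
Proof.
move=> wv ww ig vw.
have ib : P.-integrable setT (EFin \o (fun x => \sum_i `|g i x|)).
  by apply: integrable_sumR => i; exact: integrable_norm.
have mi u : weights u -> measurable_fun setT (EFin \o (fun x => \sum_i u i x * g i x)).
  by move=> wu; exact: (measurable_int _ (integrable_pairing wu ig)).
have cv : {ae P, forall x, setT x ->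
    (EFin \o (fun x => \sum_i v j i x * g i x)) x @[j --> \oo] -->
    (EFin \o (fun x => \sum_i w i x * g i x)) x}.
  apply: filterS vw => x vwx _; apply: cvg_EFin; first exact: nearW.
  by apply: cvg_sum_ord => i; apply: cvgMl; exact: vwx.
have bnd : {ae P, forall x j, setT x ->
    (`|(EFin \o (fun x => \sum_i v j i x * g i x)%R) x| <=
    (EFin \o (fun x => \sum_i `|g i x|)%R) x)%E}.
  apply: aeW => x j _ /=; rewrite lee_fin; apply: le_trans (ler_norm_sum _ _ _) _.
  apply: ler_sum => i _; rewrite normrM ler_piMl//.
  have [_ w0 _] := wv j.
  by rewrite ger0_norm//; exact: weights_le1.
have [_ _ H] := dominated_convergence measurableT (fun j => mi _ (wv j))
  (mi _ ww) cv ib bnd.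
apply: fine_cvg; rewrite fineK//.
exact: integrable_fin_num (integrable_pairing ww ig).
Qed.

(** An element [(g, b)] of [C] stands for the linear constraint [pairing g w = b]. The feasible set
    is closed under midpoints, and a sequence from [minimizing_sequence] converges almost everywhere
    to a feasible minimizer. *)
Lemma weights_lp (c : 'I_k -> T -> R) (C : set (('I_k -> T -> R) * R)) :
    integrables c -> (forall i x, 0 <= c i x) ->
    (forall gb, C gb -> integrables gb.1) ->
    (exists2 w, weights w & forall gb, C gb -> pairing gb.1 w = gb.2) ->
  exists w, [/\ weights w, forall gb, C gb -> pairing gb.1 w = gb.2 &
    forall w', weights w' -> (forall gb, C gb -> pairing gb.1 w' = gb.2) ->
      pairing c w <= pairing c w'].
Proof.
move=> ic c0 iC [w0 ww0 Cw0].
pose W := [set w | weights w /\ forall gb, C gb -> pairing gb.1 w = gb.2].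
have [||v' w'|v /all_and3[Wv minv Nv]] :=
    @minimizing_sequence R _ W midw (pairing c) sqnorm 1.
- by exists w0.
- move=> w [ww _]; split; [|exact: sqnorm_ge0|exact: sqnorm_le1].
  apply: Rintegral_ge0 => x _; apply: sumr_ge0 => i _.
  by apply: mulr_ge0 => //; case: ww.
- move=> [wv Cv] [ww Cw]; split.
    split; first exact: weights_midw.
    move=> gb Cgb; rewrite pairing_midw ?Cv ?Cw//; last exact: iC.
    by field.
  rewrite pairing_midw//.
  have := le_max (pairing c v') (pairing c v') (pairing c w').
  have := le_max (pairing c w') (pairing c v') (pairing c w').
  rewrite !lexx orbT /=; lra.
have wv j : weights (v j) by have [] := Wv j.
(* The factor 8 is the 4 of the parallelogram identity times the 2 in the bound of
   [minimizing_sequence]. *)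
have D j : sqdist (v j.+1) (v j) <= 8 * 8^-1 ^+ j.
  have -> : sqdist (v j.+1) (v j) = sqdist (v j) (v j.+1).
    apply: eq_Rintegral => x _; apply: eq_bigr => i _; ring.
  by rewrite parallelogram//; have := Nv j; lra.
have [w ww vw] : exists2 w, weights w &
    {ae P, forall x, forall i, v ^~ i ^~ x @ \oo --> w i x}.
  (* With [|t| <= (2^j t^2 + 2^-j) / 2], the L1 increment is at most [4 * 4^-j + 2^-j / 2], hence at
     most [5 * 2^-j]. *)
  apply: weights_lim => // i; apply: (@ae_cvg_geometric _ _ _ _ _ 5).
    by move=> j; have [] := wv j.
  move=> j.
  have iv n : P.-integrable setT (EFin \o v n i) by exact: integrables_weights.
  have idiff : P.-integrable setT (EFin \o (fun x => `|v j.+1 i x - v j i x|)).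
    apply: integrable_norm.
    exact: (@integrableB _ _ _ _ _ _ (EFin \o v j.+1 i) (EFin \o v j i)).
  rewrite -[leLHS]fineK; last exact: integrable_fin_num idiff.
  rewrite lee_fin.
  have i1 : P.-integrable setT (EFin \o
      (fun x => (2 ^+ j / 2) * \sum_i (v j.+1 i x - v j i x) ^+ 2)).
    by apply: integrableZ_EFin; exact: integrable_sqdist.
  have i2 : P.-integrable setT (EFin \o (fun x : T => 2^-1 ^+ j / 2)).
    exact: finite_measure_integrable_cst.
  have E2 : 2 ^+ j * 2^-1 ^+ j = 1 :> R by rewrite -exprMn divff ?expr1n.
  have p2 : 0 < 2 ^+ j :> R by rewrite exprn_gt0.
  apply: (@le_trans _ _ (\int[P]_x ((2 ^+ j / 2) *
      (\sum_i (v j.+1 i x - v j i x) ^+ 2) + 2^-1 ^+ j / 2))).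
    apply: le_Rintegral => //; first exact: integrableD_EFin.
    move=> x _.
    apply: (@le_trans _ _ ((2 ^+ j / 2) * (v j.+1 i x - v j i x) ^+ 2 + 2^-1 ^+ j / 2)).
      (* AM-GM: [2 |t| <= s t^2 + s^-1] *)
      have : 0 <= 2 ^+ j * (`|v j.+1 i x - v j i x| - 2^-1 ^+ j) ^+ 2.
        by rewrite mulr_ge0 ?sqr_ge0// ltW.
      rewrite sqrrB real_normK ?num_real//.
      set t := `|_|; set u := _ ^+ 2; set r := 2^-1 ^+ j in E2 *.
      set s := 2 ^+ j in E2 p2 *.
      have -> : s * (u - t * r *+ 2 + r ^+ 2) = s * u - 2 * t * (s * r) + r * (s * r).
        by ring.
      rewrite E2; lra.
    rewrite lerD2r ler_pM2l ?divr_gt0// (bigD1 i)//= lerDl.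
    by apply: sumr_ge0 => l _; exact: sqr_ge0.
  rewrite RintegralD// RintegralZl//; last exact: integrable_sqdist.
  rewrite Rintegral_probability_cst -/(sqdist _ _).
  apply: (@le_trans _ _ (2 ^+ j / 2 * (8 * 8^-1 ^+ j) + 2^-1 ^+ j / 2)).
    by rewrite lerD2r ler_pM2l ?divr_gt0.
  have E8 : 2 ^+ j * 8^-1 ^+ j = 2^-1 ^+ j * 2^-1 ^+ j :> R.
    by rewrite -!exprMn; congr (_ ^+ _); field.
  have -> : 2 ^+ j / 2 * (8 * 8^-1 ^+ j) = 4 * (2^-1 ^+ j * 2^-1 ^+ j) :> R.
    by rewrite -E8; field.
  have r1 : 2^-1 ^+ j <= 1 :> R by rewrite exprn_ile1//; lra.
  have r0 : 0 < 2^-1 ^+ j :> R by rewrite exprn_gt0.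
  by nra.
exists w; split=> // [gb Cgb|w' ww' Cw'].
  have := pairing_cvg wv ww (iC _ Cgb) vw.
  under eq_fun => j do (have [_ /(_ _ Cgb) ->] := Wv j).
  by move=> h; apply: (cvg_unique _ h) => //; exact: cvg_cst.
have h := pairing_cvg wv ww ic vw.
have h' : pairing c w' + 2^-1 ^+ j @[j --> \oo] --> pairing c w' + 0.
  apply: cvgD; first exact: cvg_cst.
  by apply: cvg_expr; rewrite ger0_norm ?invf_lt1 ?ltr1n.
rewrite -[leRHS]addr0 -(cvg_lim _ h)// -(cvg_lim _ h')//.
apply: ler_lim; [exact: cvgP h|exact: cvgP h'|].
by apply: nearW => j; exact: minv.
Qed.

End weights.

(** * Images and densities of measures *)

Section image_measures.
Context d d' (T : measurableType d) (S : measurableType d') (R : realType).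

Lemma measurable_preimage (phi : T -> S) (B : set S) :
  measurable_fun setT phi -> measurable B -> measurable (phi @^-1` B).
Proof. by move=> mphi mB; rewrite -[X in measurable X]setTI; exact: mphi. Qed.

(** Normalizing a measure of mass 1 does not change it and yields a bundled probability; the Dirac
    mass is the default of [mnormalize] for mass 0 or infinity. *)
Lemma probability_of_measure (m : {measure set S -> \bar R}) : m setT = 1 ->
  exists Q : probability S R, forall B, Q B = m B.
Proof.
move=> m1; exists (mnormalize m (dirac point)) => B.
by rewrite /= /mnormalize m1 onee_eq0/= invr1 mule1.
Qed.

Lemma image_probability (P : probability T R) (phi : T -> S) :
    measurable_fun setT phi ->
  exists Q : probability S R, (forall B, Q B = P (phi @^-1` B)) /\
    forall g : S -> \bar R, measurable_fun setT g -> (forall s, 0 <= g s) ->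
      \int[Q]_s g s = \int[P]_x g (phi x).
Proof.
move=> mphi; pose X : {mfun T >-> S} := HB.pack phi (isMeasurableFun.Build _ _ _ _ phi mphi).
exists (distribution P X); split=> // g mg g0.
exact: ge0_integral_distribution.
Qed.

Lemma integral_mrestr (P : {measure set T -> \bar R}) (E : set T)
    (mE : measurable E) (g : T -> \bar R) : measurable_fun setT g ->
  (forall x, 0 <= g x) -> \int[mrestr P mE]_x g x = \int[P]_(x in E) g x.
Proof.
move=> mg g0.
have mEC : measurable (~` E) by exact: measurableC.
rewrite -(setUv E) ge0_integral_setU//; [|by rewrite setUv|exact/disj_setPCl].
rewrite [X in _ + X]null_set_integral ?adde0//; last 2 first.
- exact: measurable_funTS.
- by rewrite /= /mrestr setICl measure0.
by apply: eq_measure_integral => A mA AE; rewrite /mrestr; congr (P _); apply: setIidl.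
Qed.

(** The image of [P] restricted to an event, left unnormalized. It comes as a finite measure so that
    Radon-Nikodym densities can be taken. *)
Lemma restricted_image (P : probability T R) (phi : T -> S) (E : set T) :
    measurable_fun setT phi -> measurable E ->
  exists N : {finite_measure set S -> \bar R},
    (forall B, N B = P (phi @^-1` B `&` E)) /\
    forall g : S -> \bar R, measurable_fun setT g -> (forall s, 0 <= g s) ->
      \int[N]_s g s = \int[P]_(x in E) g (phi x).
Proof.
move=> mphi mE.
unshelve epose (M := (pushforward (mrestr P mE) phi : {measure set S -> \bar R})).
  exact: mphi.
have Moo : M setT < +oo.
  by rewrite /M/= /pushforward preimage_setT /mrestr setTI ltey_eq fin_num_measure.
have NE B : mfrestr measurableT Moo B = P (phi @^-1` B `&` E).
  by rewrite /mfrestr /mrestr setIT.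
(* Restricting to the whole space changes no value; it packs the finiteness of the total mass. *)
exists (mfrestr measurableT Moo); split=> // g mg g0.
rewrite -integral_mrestr//; last exact: measurableT_comp.
rewrite -[RHS](@ge0_integral_pushforward _ _ _ _ _ _ mphi _ setT)//.
by apply: eq_measure_integral => A mA _; exact: NE.
Qed.

End image_measures.

Section density.
Context d (T : measurableType d) (R : realType).

(** The density [p] agrees almost everywhere with the Radon-Nikodym derivative of [N], for which the
    change of variables is known. *)
Lemma integral_density (P : probability T R) (N : {finite_measure set T -> \bar R})
    (p : T -> \bar R) : P.-integrable setT p ->
    (forall B, measurable B -> N B = \int[P]_(x in B) p x) ->
  forall g : T -> \bar R, measurable_fun setT g -> (forall x, 0 <= g x) ->
    \int[N]_x g x = \int[P]_x (g x * p x).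
Proof.
move=> ip NE g mg g0.
have NP : N `<< P.
  apply/null_content_dominatesP => B mB PB0; rewrite NE//.
  apply: null_set_integral => //; apply: measurable_funTS.
  exact: measurable_int ip.
rewrite -(Radon_Nikodym_SigmaFinite.change_of_variables NP)//.
have iq := Radon_Nikodym_SigmaFinite.f_integrable NP.
apply: ae_eq_integral => //.
- by apply: emeasurable_funM => //; exact: measurable_int iq.
- by apply: emeasurable_funM => //; exact: measurable_int ip.
- apply: ae_eqe_mul2l; apply: integral_ae_eq => //.
    exact: measurable_int ip.
  by move=> B _ mB; rewrite -Radon_Nikodym_SigmaFinite.f_integral ?NE.
Qed.

End density.

(** * Mixtures of Dirac kernels *)

Section mixture_kernel.
Context d d' (U : measurableType d) (Z : measurableType d') (R : realType).
Context (k : nat) (w : 'I_k -> U -> R) (phi : 'I_k -> U -> Z).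

(** The law of [phi I u] for a random index [I] with probabilities [w ^~ u]. Since [msum] runs over
    natural numbers, [insub] recovers the index in ['I_k], with the null measure as default. *)
Definition mixture (hw : weights w) (mphi : forall i, measurable_fun setT (phi i))
    (u : U) : {measure set Z -> \bar R} :=
  msum (fun n => if insub n is Some i
    then mscale (NngNum (let: And3 _ w0 _ := hw in w0 i u)) (dirac (phi i u))
    else mzero) k.

Context (hw : weights w) (mphi : forall i, measurable_fun setT (phi i)).

Lemma mixtureE u B : mixture hw mphi u B = \sum_i (w i u)%:E * \d_(phi i u) B.
Proof.
rewrite /mixture/= /msum; apply: eq_bigr => i _.
by rewrite valK.
Qed.

Lemma integral_mixture u (g : Z -> \bar R) : measurable_fun setT g ->
  (forall z, 0 <= g z) ->
  \int[mixture hw mphi u]_z g z = \sum_i (w i u)%:E * g (phi i u).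
Proof.
move=> mg g0; rewrite /mixture ge0_integral_measure_sum//.
apply: eq_bigr => i _; rewrite valK ge0_integral_mscale// integral_dirac//.
by rewrite diracT mul1e.
Qed.

Let measurable_mixture B : measurable B ->
  measurable_fun setT (mixture hw mphi ^~ B).
Proof.
move=> mB; under eq_fun do rewrite mixtureE.
apply: emeasurable_sum => i; apply: emeasurable_funM.
  by apply/measurable_EFinP; case: hw.
exact: (measurable_kernel (kdirac (mphi i)) B mB).
Qed.

HB.instance Definition _ :=
  isKernel.Build _ _ _ _ _ (mixture hw mphi) measurable_mixture.

Let mixture_setT u : mixture hw mphi u setT = 1.
Proof.
rewrite mixtureE; under eq_bigr do rewrite diracT mule1.
by rewrite sumEFin; case: hw => _ _ ->.
Qed.

HB.instance Definition _ :=
  Kernel_isProbability.Build _ _ _ _ _ (mixture hw mphi) mixture_setT.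

End mixture_kernel.

(** Two-stage sampling: [u] is drawn from [Q], seen as a constant kernel on [unit], and the mixture
    kernel is then applied at [u]. *)
Lemma mixture_law d d' (U : measurableType d) (Z : measurableType d')
    (R : realType) (k : nat) (w : 'I_k -> U -> R) (phi : 'I_k -> U -> Z)
    (Q : probability U R) :
    weights w -> (forall i, measurable_fun setT (phi i)) ->
  exists gam : probability Z R,
    forall g : Z -> \bar R, measurable_fun setT g -> (forall z, 0 <= g z) ->
    \int[gam]_z g z = \int[Q]_u \sum_i (w i u)%:E * g (phi i u).
Proof.
move=> [mw w0 w1] mphi.
have hw' : weights (fun i (x : unit * U) => w i x.2).
  by split=> // i; exact: measurableT_comp.
have mphi' i : measurable_fun setT (fun x : unit * U => phi i x.2).
  exact: measurableT_comp.
pose l : R.-pker unit ~> U := kprobability (measurable_cst (Q : pprobability U R)).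
pose K : R.-pker (unit * U) ~> Z := mixture hw' mphi'.
have [|gam gamE] := @probability_of_measure _ Z R (mkcomp l K tt).
  rewrite /= /kcomp.
  under eq_integral do rewrite prob_kernel.
  by rewrite integral_cst// mul1e prob_kernel.
exists gam => g mg g0.
rewrite (eq_measure_integral (mkcomp l K tt)); last by move=> B _ _; exact: gamE.
rewrite integral_kcomp//; apply: eq_integral => u _.
exact: integral_mixture.
Qed.

(** * One-hot labels *)

Section onehot.
Context (R : realType) (k : nat).
Implicit Types s t : k.-tuple R.

Lemma tnth_onehot (i j : 'I_k) : tnth (@onehot R k i) j = (i == j)%:R.
Proof. by rewrite tnth_mktuple. Qed.

Lemma onehot_inj : injective (@onehot R k).
Proof.
move=> i j /(congr1 (fun t => tnth t j)); rewrite !tnth_onehot eqxx.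
by case: eqVneq => // _ /eqP; rewrite eq_sym oner_eq0.
Qed.

Lemma sum_dirac_onehot (c : 'I_k -> \bar R) i :
  \sum_j c j * \d_(onehot R j) [set onehot R i] = c i.
Proof.
rewrite (bigD1 i)//= diracE mem_set// mule1 big1 ?adde0// => j ji.
rewrite diracE memNset ?mule0//= => /onehot_inj ij.
by rewrite ij eqxx in ji.
Qed.

Lemma measurable_tuple1 t : measurable [set t].
Proof.
rewrite (_ : [set t] = \big[setI/setT]_(i < k) ((@tnth k R)^~ i @^-1` [set tnth t i])).
  apply: bigsetI_measurable => i _; rewrite -[X in measurable X]setTI.
  exact: measurable_tnth.
apply/seteqP; split=> [s ->|s]; rewrite -bigcap_seq/= => h.
  by [].
by apply/eq_from_tnth => i; apply: h => /=; rewrite mem_index_enum.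
Qed.

Lemma measurable_Yset : measurable (@Yset R k).
Proof.
rewrite (_ : @Yset R k = \big[setU/set0]_(i < k) [set onehot R i]).
  by apply: bigsetU_measurable => i _; exact: measurable_tuple1.
rewrite -bigcup_seq; apply/seteqP; split=> [_ [i ->]|s [i _ ->]].
  by exists i => //=; rewrite mem_index_enum.
by exists i.
Qed.

Lemma l1dist_ge0 s t : (0 <= l1dist s t)%R.
Proof. exact: sumr_ge0. Qed.

(** Coordinate [i] contributes [1 - s_i], and the other coordinates of [s] also add up to
    [1 - s_i]. *)
Lemma l1dist_onehot s i : (forall j, 0 <= tnth s j)%R -> (\sum_j tnth s j = 1)%R ->
  l1dist s (onehot R i) = (2 * (1 - tnth s i))%R.
Proof.
move=> s0 s1; rewrite /l1dist (bigD1 i)//= tnth_onehot eqxx.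
have s_le1 : (tnth s i <= 1)%R by rewrite -s1 (bigD1 i)//= lerDl sumr_ge0.
rewrite (eq_bigr (fun j => tnth s j)); last first.
  by move=> j ji; rewrite tnth_onehot eq_sym (negbTE ji) subr0 ger0_norm.
have -> : (\sum_(j | j != i) tnth s j = 1 - tnth s i)%R.
  by move: s1; rewrite (bigD1 i)//=; lra.
rewrite ler0_norm ?subr_le0//=; ring.
Qed.

Lemma measurable_l1dist d (T : measurableType d) (f g : T -> k.-tuple R) :
  measurable_fun setT f -> measurable_fun setT g ->
  measurable_fun setT (fun x => l1dist (f x) (g x)).
Proof.
move=> mf mg; apply: measurable_sum => i; apply: measurableT_comp => //.
by apply: measurable_funB; apply: (measurableT_comp (measurable_tnth i)).
Qed.

(** The events [Y = e_i] are disjoint and cover the space up to a null set. *)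
Lemma integral_onehot_split d (T : measurableType d) (P : probability T R)
    (Y : T -> k.-tuple R) (g : T -> \bar R) : measurable_fun setT Y ->
    P [set z | Yset (Y z)] = 1 -> measurable_fun setT g -> (forall z, 0 <= g z) ->
  \int[P]_z g z = \sum_i \int[P]_(z in [set z | Y z = onehot R i]) g z.
Proof.
move=> mY PY mg g0.
have mD i : measurable [set z | Y z = onehot R i].
  rewrite -[X in measurable X]setTI; exact: (mY _ _ (measurable_tuple1 _)).
have mDY : measurable [set z | Yset (Y z)].
  rewrite -[X in measurable X]setTI; exact: (mY _ _ measurable_Yset).
under [RHS]eq_bigr do rewrite integral_mkcond.
have mgD i : measurable_fun setT (g \_ [set z | Y z = onehot R i]).
  by apply/(measurable_restrictT _ (mD i)); exact: measurable_funTS.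
have g0D i z : 0 <= (g \_ [set z | Y z = onehot R i]) z.
  by rewrite patchE; case: ifPn.
rewrite -ge0_integral_sum//.
apply: ge0_ae_eq_integral => //.
- exact: emeasurable_sum.
- by move=> z _; apply: sume_ge0.
exists (~` [set z | Yset (Y z)]); split.
- exact: measurableC.
- by rewrite [LHS](probability_setC P mDY) PY subee.
move=> z /= H [i Yi]; apply: H => _.
rewrite (bigD1 i)//= patchE mem_set// big1 ?adde0// => j ji.
rewrite patchE memNset//= Yi => /onehot_inj ij.
by rewrite ij eqxx in ji.
Qed.

Lemma finite_supportE (q : probability (k.-tuple R) R) B : in_Qk q ->
  measurable B -> q B = \sum_i q [set onehot R i] * \d_(onehot R i) B.
Proof.
move=> qY mB; have -> : q B = \int[q]_z (\1_B z)%:E by rewrite integral_indic// setIT.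
rewrite (@integral_onehot_split _ _ q id)//; last exact/measurable_EFinP.
apply: eq_bigr => i _; rewrite integral_indic//; last exact: measurable_tuple1.
rewrite diracE; case: (boolP (onehot R i \in B)) => [/set_mem Bi|/negP Bi].
  rewrite mule1; congr (q _).
  by apply/seteqP; split=> [s [_ ->]//|s /= ->]; split.
rewrite mule0 (_ : _ `&` _ = set0) ?measure0//.
by apply/seteqP; split=> // s [+ /= si]; rewrite si => /mem_set.
Qed.

Lemma finite_support_sum (q : probability (k.-tuple R) R) : in_Qk q ->
  \sum_i q [set onehot R i] = 1.
Proof.
move=> qY; rewrite -(probability_setT q) (finite_supportE qY measurableT).
by apply: eq_bigr => i _; rewrite diracT mule1.
Qed.

End onehot.

(** * Couplings and weights *)

Section transport_weights.
Context d (U : measurableType d) (R : realType) (k : nat).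
Context (Q : probability U R) (F : U -> k.-tuple R).
Context (mF : measurable_fun setT F).
Implicit Types (w : 'I_k -> U -> R) (q : probability (k.-tuple R) R).

Definition weights_cost w : \bar R :=
  \int[Q]_u (\sum_i w i u * l1dist (F u) (onehot R i))%:E.

Let ml1 i : measurable_fun setT (fun u => l1dist (F u) (onehot R i)).
Proof. exact: measurable_l1dist. Qed.

Lemma weights_costE w : weights w ->
  weights_cost w = \sum_i \int[Q]_u (l1dist (F u) (onehot R i) * w i u)%:E.
Proof.
move=> [mw w0 _]; rewrite -ge0_integral_sum//.
- by apply: eq_integral => u _; rewrite sumEFin; congr EFin; apply: eq_bigr => i _; rewrite mulrC.
- by move=> i; apply/measurable_EFinP; exact: measurable_funM.
- by move=> i u _; rewrite lee_fin mulr_ge0// l1dist_ge0.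
Qed.

(** The coupling is the law of [(F u, e_I)], with [u] drawn from [Q] and [I] from [w ^~ u]. Its
    first marginal is [r] because weights sum to 1, and its second is [q] because [q] is determined
    by its masses on the labels. *)
Lemma coupling_of_weights (r : set (k.-tuple R) -> \bar R) q w :
    (forall B, measurable B -> r B = Q (F @^-1` B)) -> in_Qk q -> weights w ->
    (forall i, \int[Q]_u (w i u)%:E = q [set onehot R i]) ->
  exists2 g, coupling r q g & transport_cost g = weights_cost w.
Proof.
move=> rE qY ww wq; have [mw w0 w1] := ww.
have mphi (i : 'I_k) : measurable_fun setT (fun u => (F u, onehot R i)).
  exact: measurable_fun_pair.
have [g gE] := mixture_law Q ww mphi.
exists g; last first.
  rewrite /transport_cost gE; last 2 first.
  - by apply/measurable_EFinP; exact: measurable_l1dist.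
  - by move=> z; rewrite lee_fin l1dist_ge0.
  by apply: eq_integral => u _; rewrite -sumEFin.
have gS S : measurable S ->
    g S = \int[Q]_u \sum_i (w i u)%:E * (\1_S (F u, onehot R i))%:E.
  move=> mS; have -> : g S = \int[g]_z (\1_S z)%:E by rewrite integral_indic// setIT.
  by rewrite gE//; exact/measurable_EFinP.
move=> B mB; split.
  rewrite gS; last exact: measurableX.
  rewrite rE//.
  have mFB : measurable (F @^-1` B) by rewrite -[X in measurable X]setTI; exact: mF.
  rewrite -[RHS]mul1e -[RHS]integral_cst// integral_mkcond.
  apply: eq_integral => u _; rewrite patchE.
  under eq_bigr => i _ do rewrite indicE in_setX/= (in_setT (onehot R i)) andbT.
  rewrite (_ : (u \in F @^-1` B) = (F u \in B)); last by apply/idP/idP => /set_mem ?; exact/mem_set.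
  case: (F u \in B) => /=.
    by under eq_bigr do rewrite mule1; rewrite sumEFin w1.
  by rewrite big1// => i _; rewrite mule0.
rewrite gS; last exact: measurableX.
rewrite (finite_supportE qY mB).
transitivity (\int[Q]_u \sum_i (w i u)%:E * \d_(onehot R i) B).
  apply: eq_integral => u _; apply: eq_bigr => i _.
  by rewrite diracE indicE in_setX/= in_setT.
have mwE (i : 'I_k) : measurable_fun setT (fun u => (w i u)%:E).
  exact/measurable_EFinP.
rewrite ge0_integral_sum//.
- apply: eq_bigr => i _; rewrite -wq ge0_integralZr// => u _.
  by rewrite lee_fin.
- by move=> i; apply: emeasurable_funM.
- by move=> i u _; rewrite mule_ge0// lee_fin.
Qed.


(** The weights are conditional probabilities of the labels given the first coordinate under [g],
    and so depend on [u] only through [F u]. *)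
Lemma weights_of_coupling (r : set (k.-tuple R) -> \bar R) q
    (g : probability (k.-tuple R * k.-tuple R)%type R) (i0 : 'I_k) :
    (forall B, measurable B -> r B = Q (F @^-1` B)) -> in_Qk q -> coupling r q g ->
  exists v : 'I_k -> k.-tuple R -> R,
    [/\ weights v, forall i, \int[Q]_u (v i (F u))%:E = q [set onehot R i] &
        weights_cost (fun i u => v i (F u)) = transport_cost g].
Proof.
move=> rE qY gc.
have [rho [rhoE irho]] := image_probability Q mF.
have grho B : measurable B -> g (fst @^-1` B) = rho B.
  by move=> mB; rewrite rhoE -rE// -(gc B mB).1; congr (g _); apply/seteqP; split=> z //= [].
have mY (i : 'I_k) : measurable [set z : k.-tuple R * k.-tuple R | z.2 = onehot R i].
  rewrite -[X in measurable X]setTI.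
  by apply: (@measurable_snd _ _ _ _ measurableT [set onehot R i]); exact: measurable_tuple1.
have mfst B : measurable B -> measurable ((@fst (k.-tuple R) (k.-tuple R)) @^-1` B).
  by move=> mB; rewrite -[X in measurable X]setTI; exact: measurable_fst.
have gY : g [set z | Yset z.2] = 1.
  rewrite -[RHS]qY -(gc _ (@measurable_Yset R k)).2.
  by congr (g _); apply/seteqP; split=> z //= [].
have /choice[N /all_and2[NE iN]] : forall i : 'I_k,
    exists N : {finite_measure set (k.-tuple R) -> \bar R},
    (forall B, N B = g (fst @^-1` B `&` [set z | z.2 = onehot R i])) /\
    forall h : k.-tuple R -> \bar R, measurable_fun setT h -> (forall s, 0 <= h s) ->
      \int[N]_s h s = \int[g]_(z in [set z | z.2 = onehot R i]) h z.1.
  by move=> i; apply: restricted_image => //; exact: mY.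
have Nrho i : N i `<< rho.
  apply/null_content_dominatesP => B mB rhoB.
  have gB : g (fst @^-1` B) = 0 by rewrite grho.
  apply/eqP; rewrite eq_le measure_ge0 andbT NE -gB.
  by apply: le_measure; rewrite ?inE//; [apply: measurableI => //|]; exact: mfst.
have /choice[p /all_and4[p0 pfin ip pE]] : forall i, exists p : k.-tuple R -> \bar R,
    [/\ forall s, 0 <= p s, forall s, p s \is a fin_num,
      rho.-integrable [set: k.-tuple R] p
    & forall A, measurable A -> N i A = \int[rho]_(s in A) p s].
  by move=> i; exact: radon_nikodym_sigma_finite.
have mp i : measurable_fun setT (p i) by exact: measurable_int (ip i).
have sumN B : measurable B -> \sum_i N i B = rho B.
  move=> mB; rewrite -grho//.
  have := mfst _ mB; set D := fst @^-1` B => mD.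
  have -> : g D = \int[g]_z (\1_D z)%:E by rewrite integral_indic ?setIT.
  rewrite (@integral_onehot_split _ _ _ _ g snd)//; last exact/measurable_EFinP.
  by apply: eq_bigr => i _; rewrite integral_indic ?NE.
(* The measures [N i] add up to the first marginal [rho], so their densities add up to 1 almost
   everywhere. *)
have sum1 : ae_eq rho setT (fun s => \sum_i p i s) (cst 1).
  apply: integral_ae_eq => //.
    by apply: integrable_sum => // i _; exact: ip.
  move=> B _ mB.
  rewrite ge0_integral_sum//; last by move=> i; exact: measurable_funTS.
  rewrite integral_cst// mul1e; apply: etrans (sumN _ mB).
  by apply: eq_bigr => i _; rewrite pE.
pose S := [set s | (\sum_i fine (p i s) = 1)%R].
have mfp i : measurable_fun setT (fun s => fine (p i s)).
  by apply: measurableT_comp => //; exact: mp.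
have mS : measurable S.
  have := measurable_sum (index_enum 'I_k) mfp.
  by move=> /(_ measurableT [set 1%R] (measurable_set1 _)); rewrite setTI.
(* Off the set [S] of full measure all the weight goes to the default label [i0], so that the
   weights sum to 1 at every point. *)
pose v i s := if s \in S then fine (p i s) else (i == i0)%:R.
have wv : weights v.
  split=> [i|i s|s]; rewrite /v.
  - by apply: measurable_fun_ifT => //; exact: measurable_mem.
  - by case: (s \in S) => //; exact: fine_ge0.
  - have [/set_mem//|_] := boolP (s \in S).
    by rewrite (bigD1 i0)//= eqxx big1 ?addr0// => i /negbTE ->.
have vp i : ae_eq rho setT (EFin \o v i) (p i).
  apply: filterS sum1 => s /(_ I) ps _; rewrite /= /v mem_set ?fineK//.
  apply: EFin_inj; rewrite -sumEFin -[RHS]ps.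
  by apply: eq_bigr => j _; rewrite fineK.
have mv i : measurable_fun setT (EFin \o v i) by apply/measurable_EFinP; case: wv.
have v0 i s : 0 <= (v i s)%:E by rewrite lee_fin; case: wv.
(* Used twice below: [h = 1] gives the label masses, and the distance to [e_i] gives the cost. *)
have ivp i h : measurable_fun setT h -> (forall s, 0 <= h s) ->
    \int[Q]_u (h (F u) * (v i (F u))%:E) =
    \int[g]_(z in [set z | z.2 = onehot R i]) h z.1.
  move=> mh h0.
  rewrite -(irho (fun s => h s * (v i s)%:E)); last 2 first.
  - by apply: emeasurable_funM => //; exact: mv.
  - by move=> s; rewrite mule_ge0// v0.
  rewrite -iN// [RHS](integral_density (ip i))//; last exact: pE.
  apply: ae_eq_integral => //; [|exact: emeasurable_funM|].
    by apply: emeasurable_funM => //; exact: mv.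
  exact: (ae_eqe_mul2l h (vp i)).
exists v; split=> [//|i|].
  have := ivp i (cst 1) (measurable_cst _) (fun=> lee01).
  under eq_integral do rewrite mul1e.
  move=> ->; rewrite [LHS](integral_cst _ (mY i)).
  rewrite mul1e -(gc _ (measurable_tuple1 _)).2.
  by congr (g _); apply/seteqP; split=> z //= [].
rewrite weights_costE; last first.
  have [mv' v0' v1'] := wv; split=> // i.
  exact: measurableT_comp.
rewrite /transport_cost (integral_onehot_split measurable_snd gY); last 2 first.
- by apply/measurable_EFinP; exact: measurable_l1dist.
- by move=> z; rewrite lee_fin l1dist_ge0.
apply: eq_bigr => i _.
transitivity (\int[g]_(z in [set z | z.2 = onehot R i]) (l1dist z.1 (onehot R i))%:E).
  rewrite -(ivp i (fun s => (l1dist s (onehot R i))%:E))//.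
    by apply/measurable_EFinP; exact: measurable_l1dist.
  by move=> s; rewrite lee_fin l1dist_ge0.
by apply: eq_integral => z /set_mem /= ->.
Qed.

(** Labels drawn independently of [u] correspond to the product coupling; this is the feasible point
    in [optimal_coupling]. *)
Lemma weights_cst_law q : in_Qk q ->
  weights (fun i (u : U) => fine (q [set onehot R i])).
Proof.
move=> qY; split=> [j|j u|u].
- exact: measurable_cst.
- exact: fine_ge0.
- apply: EFin_inj; rewrite -(finite_support_sum qY) -sumEFin.
  by apply: eq_bigr => j _; rewrite fineK// fin_num_measure//; exact: measurable_tuple1.
Qed.

(** Among weights with label masses prescribed by [q], a cheapest family exists by [weights_lp]. It
    gives a coupling, and every other coupling gives a competing family of equal cost. *)
Lemma optimal_coupling (r : set (k.-tuple R) -> \bar R) q (i0 : 'I_k) :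
    (forall i, Q.-integrable setT (fun u => (l1dist (F u) (onehot R i))%:E)) ->
    (forall B, measurable B -> r B = Q (F @^-1` B)) -> in_Qk q ->
  exists2 g, coupling r q g & transport_cost g = W1 r q.
Proof.
move=> il1 rE qY.
(* Pairing with [ev i] extracts the total mass of label [i]. *)
pose ev i : 'I_k -> U -> R := fun j _ => (j == i)%:R.
have pE i w : pairing Q (ev i) w = (\int[Q]_u (w i u))%R.
  apply: eq_Rintegral => u _; rewrite (bigD1 i)//= /ev eqxx mulr1 big1 ?addr0// => j.
  by move=> /negbTE ->; rewrite mulr0.
have qfin i : q [set onehot R i] \is a fin_num.
  by rewrite fin_num_measure//; exact: measurable_tuple1.
have iw i w : weights w -> Q.-integrable setT (EFin \o w i).
  by move=> ww; exact: integrables_weights.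
have EpE i w : weights w -> (pairing Q (ev i) w)%:E = \int[Q]_u (w i u)%:E.
  by move=> ww; rewrite pE fineK//; exact: integrable_fin_num (iw i w ww).
pose c i u := l1dist (F u) (onehot R i).
have cE w : weights w -> (pairing Q c w)%:E = weights_cost w.
  move=> ww; rewrite fineK//.
  by apply: integrable_fin_num => //; exact: integrable_pairing.
have [w [ww wq wmin]] : exists w, [/\ weights w,
    forall gb, [set (ev i, fine (q [set onehot R i])) | i in setT] gb ->
      pairing Q gb.1 w = gb.2 &
    forall w', weights w' -> (forall gb, [set (ev i, fine (q [set onehot R i])) | i in setT] gb ->
      pairing Q gb.1 w' = gb.2) -> (pairing Q c w <= pairing Q c w')%R].
  apply: weights_lp => //.
  - by move=> i u; exact: l1dist_ge0.
  - move=> _ [i _ <-] j; exact: finite_measure_integrable_cst.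
  - exists (fun i _ => fine (q [set onehot R i])); first exact: weights_cst_law.
    by move=> _ [i _ <-]; rewrite pE Rintegral_probability_cst.
have wq' i : \int[Q]_u (w i u)%:E = q [set onehot R i].
  by rewrite -EpE// (wq (ev i, fine (q [set onehot R i])))/= ?fineK//; exists i.
have [g gc gw] := coupling_of_weights rE qY ww wq'.
exists g => //; apply/eqP; rewrite eq_le; apply/andP; split; last first.
  by apply: ereal_inf_lbound; exists g.
apply: le_ereal_inf_tmp => _ [g' gc' <-].
have [v [wv vq <-]] := weights_of_coupling i0 rE qY gc'.
have wvF : weights (fun i u => v i (F u)).
  by have [mv v0 v1] := wv; split=> // i; exact: measurableT_comp.
rewrite gw -!cE// lee_fin; apply: wmin => // _ [i _ <-] /=.
by apply: EFin_inj; rewrite EpE// vq fineK.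
Qed.

End transport_weights.

(** * The law of features and groups *)

Section projection.
Context d (X : measurableType d) (R : realType) (k : nat).
Local Notation Omega := (X * k.-tuple R * nat)%type.

Definition projXA (z : Omega) : (X * nat)%type := (z.1.1, z.2).

Lemma measurable_projXA : measurable_fun setT projXA.
Proof.
apply: measurable_fun_pair; last exact: measurable_snd.
exact: measurableT_comp measurable_fst measurable_fst.
Qed.

HB.instance Definition _ := isMeasurableFun.Build _ _ _ _ projXA measurable_projXA.

Definition lawXA (mu : probability Omega R) : probability (X * nat)%type R :=
  distribution mu projXA.

End projection.

(** * The Bayes regressor as a density *)

Section bayes.
Context d (X : measurableType d) (R : realType) (k m : nat).
Local Notation Omega := (X * k.-tuple R * nat)%type.
Local Notation U := (X * nat)%type.
Context (mu : probability Omega R) (f : X -> nat -> k.-tuple R).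
Context (cmu : classification_problem m mu) (bf : bayes_regressor mu f).

Local Notation nu := (lawXA mu).
Local Notation F := (fun u : U => f u.1 u.2).

Lemma measurable_regressor : measurable_fun setT F. Proof. exact: bf.1. Qed.

Lemma measurable_label : measurable_fun setT (fun z : Omega => z.1.2).
Proof. exact: measurableT_comp measurable_snd measurable_fst. Qed.

Let mFi i : measurable_fun setT (fun u : U => (tnth (F u) i)%:E).
Proof.
apply/measurable_EFinP; apply: (measurableT_comp (measurable_tnth i)).
exact: measurable_regressor.
Qed.

Let mlab i : measurable [set z : Omega | z.1.2 = onehot R i].
Proof. exact: measurable_preimage measurable_label (measurable_tuple1 _). Qed.

Let mlabY : measurable [set z : Omega | Yset z.1.2].
Proof. exact: measurable_preimage measurable_label (@measurable_Yset R k). Qed.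

Let mpre (B : set U) : measurable B -> measurable (projXA (R:=R) (k:=k) @^-1` B).
Proof. exact: measurable_preimage (@measurable_projXA _ X R k). Qed.

Lemma lawXA_E B : nu B = mu (projXA (R:=R) (k:=k) @^-1` B). Proof. by []. Qed.

Lemma ge0_integral_lawXA (g : U -> \bar R) : measurable_fun setT g ->
  (forall u, 0 <= g u) -> \int[nu]_u g u = \int[mu]_z g (projXA z).
Proof. by move=> mg g0; exact: ge0_integral_distribution. Qed.

Lemma integrable_regressor i : nu.-integrable setT (fun u => (tnth (F u) i)%:E).
Proof.
apply/integrableP; split=> //.
rewrite ge0_integral_lawXA//; last exact: measurableT_comp.
by have /integrableP[] := (bf.2 i).1.
Qed.

(** Almost surely coordinate [i] of the label is the indicator of [Y = e_i]; the defining property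
    of conditional expectation then makes [f_i] the density of that event over the law of (X, A). *)
Lemma integral_regressor i B : measurable B ->
  \int[nu]_(u in B) (tnth (F u) i)%:E =
  mu (projXA (R:=R) (k:=k) @^-1` B `&` [set z | z.1.2 = onehot R i]).
Proof.
move=> mB; transitivity (\int[mu]_(z in projXA (R:=R) (k:=k) @^-1` B) (tnth (F (projXA z)) i)%:E).
  apply: (integral_pushforward (@measurable_projXA _ X R k)) => //.
  apply: integrableS (bf.2 i).1 => //; exact: mpre.
rewrite -((bf.2 i).2 _ mB) setIC -integral_indic//; last exact: mpre.
apply: ae_eq_integral; first exact: mpre.
- apply/measurable_EFinP; apply: measurable_funTS.
  apply: (measurableT_comp (measurable_tnth i)); exact: measurable_label.
- by apply/measurable_EFinP; apply: measurable_funTS; exact: measurable_indic.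
have mS : measurable (setT `*` Yset (R:=R) (k:=k) `*` Aset m : set Omega).
  by apply: measurableX => //; apply: measurableX => //; exact: measurable_Yset.
exists (~` (setT `*` Yset (R:=R) (k:=k) `*` Aset m)); split.
- exact: measurableC.
- by rewrite [LHS](probability_setC mu mS) cmu.1 subee.
move=> z /= H [[_ [j zj]] _]; apply: H => _.
rewrite zj tnth_onehot indicE; congr ((nat_of_bool _)%:R%:E).
apply/idP/idP => [/eqP ji|/set_mem /=]; first by apply/mem_set; rewrite /= zj ji.
by rewrite zj => /onehot_inj ->.
Qed.

(** A version of the conditional expectation is in the simplex only almost everywhere. Each
    coordinate equals a nonnegative Radon-Nikodym density almost everywhere, and the sum is 1
    because the label events exhaust the space. *)
Lemma regressor_simplex :
  {ae nu, forall u, (forall i, (0 <= tnth (F u) i)%R) /\ (\sum_i tnth (F u) i = 1)%R}.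
Proof.
have ge0 i : {ae nu, forall u, (0 <= tnth (F u) i)%R}.
  have [N [NE _]] := restricted_image mu (@measurable_projXA _ X R k) (mlab i).
  have Nnu : N `<< nu.
    apply/null_content_dominatesP => B mB nuB.
    apply/eqP; rewrite eq_le measure_ge0 andbT NE.
    have <- : mu (projXA (R:=R) (k:=k) @^-1` B) = 0 by rewrite -lawXA_E.
    by apply: le_measure; rewrite ?inE//; [apply: measurableI => //|]; exact: mpre.
  have [p [p0 _ ip pE]] := radon_nikodym_sigma_finite Nnu.
  have : ae_eq nu setT (fun u => (tnth (F u) i)%:E) p.
    apply: integral_ae_eq => //; [exact: integrable_regressor|exact: measurable_int ip|].
    by move=> B _ mB; rewrite -pE// NE integral_regressor.
  by apply: filterS => u /(_ I) Fp; rewrite -lee_fin Fp.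
have sum1 : ae_eq nu setT (fun u => \sum_i (tnth (F u) i)%:E) (cst 1).
  apply: integral_ae_eq => //.
    by apply: integrable_sum => // i _; exact: integrable_regressor.
  move=> B _ mB; rewrite integral_sum//; last first.
    by move=> i; apply: integrableS (integrable_regressor i).
  rewrite integral_cst// mul1e.
  have mD := mpre mB.
  transitivity (\int[mu]_z (\1_(projXA (R:=R) (k:=k) @^-1` B) z)%:E); last first.
    by rewrite integral_indic// setIT.
  rewrite (integral_onehot_split measurable_label)//.
  - by apply: eq_bigr => i _; rewrite integral_indic// integral_regressor.
  - apply/eqP; rewrite eq_le probability_le1//=.
    rewrite -cmu.1; apply: le_measure; rewrite ?inE.
    + by apply: measurableX => //; apply: measurableX => //; exact: measurable_Yset.
    + exact: mlabY.
    + by move=> z [[]].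
  - exact/measurable_EFinP.
have allge0 : {ae nu, forall u, forall i, (0 <= tnth (F u) i)%R}.
  exact: (filter_forall _ ge0).
apply: filterS2 sum1 allge0 => u /(_ I) s1 s0.
by split=> //; apply: EFin_inj; rewrite -sumEFin.
Qed.

Lemma integrable_l1dist i : nu.-integrable setT (fun u => (l1dist (F u) (onehot R i))%:E).
Proof.
apply: (@integrable_sumR _ _ _ nu _ _
  (fun j u => `|tnth (F u) j - tnth (onehot R i) j|%R)) => j.
apply: integrable_norm.
apply: (@integrableB _ _ _ _ _ _ (fun u => (tnth (F u) j)%:E)
  (EFin \o cst (tnth (onehot R i) j))) => //.
  exact: integrable_regressor.
exact: finite_measure_integrable_cst.
Qed.

Lemma error_density i B : measurable B ->
  mu (projXA (R:=R) (k:=k) @^-1` B `&` [set z | z.1.2 <> onehot R i]) =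
  \int[nu]_(u in B) (l1dist (F u) (onehot R i) / 2)%:E.
Proof.
move=> mB.
transitivity (\int[nu]_(u in B) (1 - (tnth (F u) i)%:E)); last first.
  apply: ae_eq_integral => //.
  - by apply: measurable_funTS; apply: emeasurable_funB.
  - apply: measurable_funTS; apply/measurable_EFinP; apply: measurable_funM => //.
    by apply: measurable_l1dist => //; exact: measurable_regressor.
  apply: filterS regressor_simplex => u [s0 s1] _.
  by rewrite -EFinB l1dist_onehot//; congr EFin; field.
rewrite integralB//; last 2 first.
- exact: (finite_measure_integrable_cst nu 1).
- by apply: integrableS (integrable_regressor i).
rewrite integral_cst// mul1e integral_regressor//.
have mD := mpre mB.
have -> : [set z : Omega | z.1.2 <> onehot R i] = ~` [set z | z.1.2 = onehot R i] by [].
rewrite -setDE measureD//.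
by rewrite ltey_eq fin_num_measure.
Qed.

End bayes.

(** * Conditional laws and errors *)

Section conditional_laws.
Context d (X : measurableType d) (R : realType) (k m : nat).
Local Notation Omega := (X * k.-tuple R * nat)%type.
Local Notation U := (X * nat)%type.
Context (mu : probability Omega R) (f : X -> nat -> k.-tuple R).
Context (cmu : classification_problem m mu) (bf : bayes_regressor mu f).

Local Notation nu := (lawXA mu).
Local Notation F := (fun u : U => f u.1 u.2).
Local Notation proj := (projXA (R:=R) (k:=k)).
Local Notation inv_prob a := ((fine (probA mu a))^-1)%R.

Definition slice a := [set u : U | u.2 = a].

Lemma measurable_slice a : measurable (slice a).
Proof. exact: (measurable_preimage (B := [set a]) measurable_snd). Qed.

Lemma measurable_slice_event a : measurable [set z : Omega | z.2 = a].
Proof. exact: (measurable_preimage (B := [set a]) measurable_snd). Qed.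

Lemma inv_prob_gt0 a : Aset m a -> (0 < inv_prob a)%R.
Proof.
move=> Aa; rewrite invr_gt0; apply: fine_gt0; rewrite cmu.2//=.
by rewrite ltey_eq fin_num_measure//; exact: measurable_slice_event.
Qed.

(** [Q] is the law of (X, A) given [A = a]. It lives on the full product space, so that one family
    of weights serves all groups. *)
Lemma conditional_law a : Aset m a -> exists Q : probability U R,
  forall g : U -> \bar R, measurable_fun setT g -> (forall u, 0 <= g u) ->
    \int[Q]_u g u = (\int[mu]_(z in [set z | z.2 = a]) g (projXA z)) * (inv_prob a)%:E.
Proof.
move=> Aa; have g0 := inv_prob_gt0 Aa.
have [N [NE iN]] := restricted_image mu (@measurable_projXA _ X R k) (measurable_slice_event a).
have [|Q QE] := @probability_of_measure _ _ _ (mscale (NngNum (ltW g0)) N).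
  transitivity ((inv_prob a)%:E * probA mu a).
    by congr (_ * _); rewrite [LHS]NE preimage_setT setTI.
  rewrite -[X in _ * X]fineK; last first.
    by rewrite fin_num_measure//; exact: measurable_slice_event.
  by rewrite -EFinM mulVf//; apply: lt0r_neq0; rewrite -invr_gt0.
exists Q => h mh h0.
rewrite (eq_measure_integral (mscale (NngNum (ltW g0)) N)); last by move=> B _ _; exact: QE.
by rewrite ge0_integral_mscale//= iN// muleC.
Qed.

(** The density of the law given [A = a] with respect to the law of (X, A). *)
Definition slice_density a (u : U) : R := (\1_(slice a) u * inv_prob a)%R.

Lemma measurable_slice_density a : measurable_fun setT (slice_density a).
Proof.
by apply: measurable_funM => //; apply: measurable_indic; exact: measurable_slice.
Qed.

Lemma slice_density_ge0 a u : (0 <= slice_density a u)%R.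
Proof.
apply: mulr_ge0 => //; rewrite invr_ge0; exact: fine_ge0.
Qed.

Context (Q : nat -> probability U R).
Context (QE : forall a, Aset m a ->
  forall g : U -> \bar R, measurable_fun setT g -> (forall u, 0 <= g u) ->
    \int[Q a]_u g u = (\int[mu]_(z in [set z | z.2 = a]) g (projXA z)) * (inv_prob a)%:E).

Lemma integral_conditional a (g : U -> R) : Aset m a -> measurable_fun setT g ->
  (forall u, 0 <= g u)%R ->
  \int[Q a]_u (g u)%:E = \int[nu]_u (g u * slice_density a u)%:E.
Proof.
move=> Aa mg g0; rewrite QE//; [|exact/measurable_EFinP].
have mgd : measurable_fun setT (fun u => (g u * slice_density a u)%:E).
  by apply/measurable_EFinP; apply: measurable_funM => //; exact: measurable_slice_density.
rewrite ge0_integral_lawXA//; last by move=> u; rewrite lee_fin mulr_ge0// slice_density_ge0.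
rewrite -ge0_integralZr//.
- rewrite integral_mkcond; apply: eq_integral => z _.
  rewrite patchE /slice_density indicE.
  have -> : (z \in [set z : Omega | z.2 = a]) = (projXA z \in slice a).
    by apply/idP/idP => /set_mem h; exact/mem_set.
  by case: (_ \in slice a); rewrite ?mul1r ?mul0r ?mulr0.
- exact: measurable_slice_event.
- apply: measurable_funTS; apply/measurable_EFinP.
  by apply: measurableT_comp => //; exact: measurable_projXA.
- by move=> z _; rewrite lee_fin.
- by rewrite lee_fin ltW// inv_prob_gt0.
Qed.

Lemma eq_integral_conditional a (g h : U -> R) : Aset m a ->
    measurable_fun setT g -> measurable_fun setT h ->
    (forall u, 0 <= g u)%R -> (forall u, 0 <= h u)%R ->
    (forall u, u.2 = a -> g u = h u) ->
  \int[Q a]_u (g u)%:E = \int[Q a]_u (h u)%:E.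
Proof.
move=> Aa mg mh g0 h0 gh; rewrite !QE//; try exact/measurable_EFinP.
by congr (_ * _); apply: eq_integral => z /set_mem /= za; rewrite gh.
Qed.

Lemma rstarE a B : Aset m a -> measurable B ->
  rstar mu f a B = Q a ((fun u : U => f u.1 u.2) @^-1` B).
Proof.
move=> Aa mB.
have mD : measurable (F @^-1` B).
  exact: measurable_preimage (measurable_regressor bf) mB.
have -> : Q a (F @^-1` B) = \int[Q a]_u (\1_(F @^-1` B) u)%:E.
  by rewrite integral_indic// setIT.
rewrite QE//; last exact/measurable_EFinP.
congr (_ * _).
rewrite (integral_indic mu (measurable_slice_event a) (A := proj @^-1` (F @^-1` B))); last first.
  exact: measurable_preimage (@measurable_projXA _ X R k) mD.
congr (mu _); apply/seteqP; split=> [z [za Bz]|z [/= Bz za]]; split=> //=.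
- by rewrite za.
- by rewrite -za.
Qed.

Lemma integrable_l1dist_density a i : Aset m a ->
  nu.-integrable setT (EFin \o (fun u => l1dist (F u) (onehot R i) * slice_density a u)%R).
Proof.
move=> Aa.
have iZ : nu.-integrable setT
    (EFin \o (fun u => inv_prob a * l1dist (F u) (onehot R i))%R).
  exact: (integrableZ_EFin (inv_prob a) (integrable_l1dist bf i)).
apply: le_integrable iZ => //.
  apply/measurable_EFinP; apply: measurable_funM; last exact: measurable_slice_density.
  by apply: measurable_l1dist => //; exact: measurable_regressor bf.
move=> u _ /=; rewrite lee_fin.
have l0 := l1dist_ge0 (F u) (onehot R i); have p0 := ltW (inv_prob_gt0 Aa).
have gd_le : (slice_density a u <= inv_prob a)%R.
  by rewrite /slice_density indicE; case: (_ \in _); rewrite ?mul1r ?mul0r.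
rewrite ger0_norm; last by rewrite mulr_ge0// slice_density_ge0.
by rewrite ger0_norm; [rewrite mulrC; exact: ler_wpM2r|rewrite mulr_ge0].
Qed.

Lemma integrable_l1dist_slice a i : Aset m a ->
  (Q a).-integrable setT (fun u => (l1dist (F u) (onehot R i))%:E).
Proof.
move=> Aa; have ml : measurable_fun setT (fun u => l1dist (F u) (onehot R i)).
  by apply: measurable_l1dist => //; exact: measurable_regressor bf.
apply/integrableP; split; first exact/measurable_EFinP.
under eq_integral do rewrite gee0_abs ?lee_fin ?l1dist_ge0//.
rewrite integral_conditional//; last by move=> u; exact: l1dist_ge0.
rewrite ltey_eq; apply/orP; left.
exact: integrable_fin_num (integrable_l1dist_density i Aa).
Qed.

Section classifier_weights.
Context (h : R.-pker U ~> k.-tuple R) (w : 'I_k -> U -> R).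
Context (ww : weights w).
Context (hw : forall u B, measurable B ->
  h u B = \sum_i (w i u)%:E * \d_(onehot R i) B).

Lemma prob_pred_weights a i : Aset m a ->
  prob_pred mu h a (onehot R i) = \int[Q a]_u (w i u)%:E.
Proof.
move=> Aa; have [mw w0 w1] := ww.
rewrite QE//; [|exact/measurable_EFinP|by move=> u; rewrite lee_fin].
congr (_ * _); apply: eq_integral => z /set_mem /= za.
rewrite hw; last exact: measurable_tuple1.
by rewrite sum_dirac_onehot /projXA za.
Qed.

(** Given (X, A), answer and true label are independent, so the conditional error is the sum over
    [i] of [w_i] times [P(Y <> e_i | X, A)], which is half of [|f - e_i|_1]. *)
Lemma Err_weights a : Aset m a ->
  Err mu h a = (2^-1)%:E * weights_cost (Q a) F w.
Proof.
move=> Aa; have [mw w0 w1] := ww.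
have mF := measurable_regressor bf.
have ml i : measurable_fun setT (fun u => l1dist (F u) (onehot R i)).
  by apply: measurable_l1dist => //; exact: mF.
have mone : measurable_fun setT (fun u => \1_(slice a) u : R).
  by apply: measurable_indic; exact: measurable_slice.
rewrite (weights_costE (Q a) mF ww).
pose T i := \int[nu]_u (l1dist (F u) (onehot R i) * w i u * \1_(slice a) u)%:E.
have T0 i : 0 <= T i.
  by apply: integral_ge0 => u _; rewrite lee_fin !mulr_ge0// l1dist_ge0.
have mT i : measurable_fun setT
    (fun u => (l1dist (F u) (onehot R i) * w i u * \1_(slice a) u)%:E).
  by apply/measurable_EFinP; do 2 apply: measurable_funM => //.
have pT i u : 0 <= (l1dist (F u) (onehot R i) * w i u * \1_(slice a) u)%:E.
  by rewrite lee_fin !mulr_ge0// l1dist_ge0.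
have -> : \sum_i \int[Q a]_u (l1dist (F u) (onehot R i) * w i u)%:E =
    \sum_i T i * (inv_prob a)%:E.
  apply: eq_bigr => i _; rewrite integral_conditional//; last 2 first.
  - by apply: measurable_funM.
  - by move=> u; rewrite mulr_ge0// l1dist_ge0.
  rewrite /T -ge0_integralZr//; last by rewrite lee_fin ltW// inv_prob_gt0.
  by apply: eq_integral => u _; rewrite -EFinM /slice_density mulrA.
rewrite -ge0_sume_distrl// muleA; congr (_ * _).
have mne i : measurable [set z : Omega | z.1.2 <> onehot R i].
  apply: measurableC.
  exact: measurable_preimage (@measurable_label _ X R k) (measurable_tuple1 _).
(* For a fixed sample point the error probability is the total weight of the labels other than the
   true one. *)
transitivity (\int[mu]_(z in [set z | z.2 = a])
    \sum_i ((w i (projXA z))%:E * (\1_[set z : Omega | z.1.2 <> onehot R i] z)%:E)).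
  apply: eq_integral => z /set_mem /= za.
  rewrite hw; last by apply: measurableC; exact: measurable_tuple1.
  apply: eq_bigr => i _; rewrite /projXA za diracE indicE.
  congr (_ * (nat_of_bool _)%:R%:E); apply/idP/idP => /set_mem /= H;
    by apply/mem_set => /=; exact: nesym.
have mwp i : measurable_fun setT (fun z : Omega => w i (projXA z)).
  by apply: measurableT_comp => //; exact: measurable_projXA.
have mterm i : measurable_fun setT
    (fun z : Omega => (w i (projXA z))%:E * (\1_[set z : Omega | z.1.2 <> onehot R i] z)%:E).
  by apply: emeasurable_funM; apply/measurable_EFinP => //; exact: measurable_indic.
rewrite ge0_integral_sum//; last 3 first.
- exact: measurable_slice_event.
- by move=> i; exact: measurable_funTS.
- by move=> i z _; rewrite mule_ge0// lee_fin.
rewrite ge0_sume_distrr//; apply: eq_bigr => i _.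
have [N [NE iN]] := restricted_image mu (@measurable_projXA _ X R k) (mne i).
have NP B : measurable B -> N B = \int[nu]_(u in B) (l1dist (F u) (onehot R i) / 2)%:E.
  by move=> mB; rewrite NE (error_density cmu bf).
have il : nu.-integrable setT (fun u => (l1dist (F u) (onehot R i) / 2)%:E).
  under eq_fun do rewrite mulrC.
  exact: (integrableZ_EFin 2^-1 (integrable_l1dist bf i)).
(* [N] is the law of (X, A) on the event [Y <> e_i]; by [error_density] it has density
   [|F - e_i|_1 / 2]. *)
transitivity (\int[N]_u (w i u * \1_(slice a) u)%:E).
  rewrite iN; last 2 first.
  - by apply/measurable_EFinP; exact: measurable_funM.
  - by move=> u; rewrite lee_fin mulr_ge0.
  rewrite integral_mkcond [RHS]integral_mkcond; apply: eq_integral => z _.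
  rewrite !patchE !indicE.
  have -> : (z \in [set z : Omega | z.2 = a]) = (projXA z \in slice a).
    by apply/idP/idP => /set_mem ?; exact/mem_set.
  by case: (_ \in slice a); case: (z \in _); rewrite ?mule1 ?mule0 ?mulr1 ?mulr0.
rewrite (integral_density il NP); last 2 first.
- by apply/measurable_EFinP; exact: measurable_funM.
- by move=> u; rewrite lee_fin mulr_ge0.
rewrite /T -ge0_integralZl//.
by apply: eq_integral => u _; rewrite -!EFinM; congr EFin; ring.
Qed.

End classifier_weights.

End conditional_laws.

(** * Optimal classifiers *)

(** A kernel concentrated on the finitely many labels is determined by its masses on them, which
    serve as weights. *)
Lemma classifier_weightsE d (X : measurableType d) (R : realType) (k : nat)
    (h : R.-pker (X * nat)%type ~> k.-tuple R) : classifier h ->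
  exists2 w : 'I_k -> X * nat -> R, weights w &
    forall u B, measurable B -> h u B = \sum_i (w i u)%:E * \d_(onehot R i) B.
Proof.
move=> hY; exists (fun i u => fine (h u [set onehot R i])).
  have hq u : exists2 q : probability (k.-tuple R) R, in_Qk q & forall B, q B = h u B.
    have [q qE] := probability_of_measure (prob_kernel (s := h) u).
    by exists q => //; rewrite /in_Qk qE; exact: hY.
  split=> [i|i u|u].
  - apply: measurableT_comp => //.
    by apply: measurable_kernel; exact: measurable_tuple1.
  - exact: fine_ge0.
  - have [q qY qE] := hq u.
    apply: EFin_inj; rewrite -(finite_support_sum qY) -sumEFin.
    apply: eq_bigr => i _; rewrite -qE fineK// fin_num_measure//.
    exact: measurable_tuple1.
move=> u B mB.
have [q qE] := probability_of_measure (prob_kernel (s := h) u).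
have qY : in_Qk q by rewrite /in_Qk qE; exact: hY.
rewrite -qE (finite_supportE qY mB); apply: eq_bigr => i _.
by rewrite -qE fineK// fin_num_measure//; exact: measurable_tuple1.
Qed.

Section glue.
Context d (X : measurableType d) (R : realType) (k : nat).
Local Notation U := (X * nat)%type.

Lemma measurable_glue (W : nat -> U -> R) : (forall a, measurable_fun setT (W a)) ->
  measurable_fun setT (fun u => W u.2 u).
Proof.
move=> mW _ B mB; rewrite setTI.
rewrite (_ : _ @^-1` B = \bigcup_a (slice (X := X) a `&` W a @^-1` B)).
  apply: bigcupT_measurable => a; apply: measurableI; first exact: measurable_slice.
  exact: measurable_preimage (mW a) mB.
by apply/seteqP; split=> [u Bu|u [a _ [/= <-]]//]; exists u.2.
Qed.

(** A classifier sees the group, so weights chosen group by group combine into one family. *)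
Lemma weights_glue (W : nat -> 'I_k -> U -> R) : (forall a, weights (W a)) ->
  weights (fun i u => W u.2 i u).
Proof.
move=> wW; split=> [i|i u|u]; last 2 first.
- by have [] := wW u.2.
- by have [] := wW u.2.
- by apply: (measurable_glue (W := fun a => W a i)) => a; have [] := wW a.
Qed.

End glue.

(** * Demographic parity as a linear program *)

Section optimal_weights.
Context d (X : measurableType d) (R : realType) (k m : nat).
Local Notation Omega := (X * k.-tuple R * nat)%type.
Local Notation U := (X * nat)%type.
Context (mu : probability Omega R) (f : X -> nat -> k.-tuple R).
Context (cmu : classification_problem m mu) (bf : bayes_regressor mu f).
Context (Q : nat -> probability U R).
Context (QE : forall a, Aset m a ->
  forall g : U -> \bar R, measurable_fun setT g -> (forall u, 0 <= g u) ->
    \int[Q a]_u g u = (\int[mu]_(z in [set z | z.2 = a]) g (projXA z)) *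
      ((fine (probA mu a))^-1)%:E).
Local Notation nu := (lawXA mu).
Local Notation F := (fun u : U => f u.1 u.2).

Definition total_cost (w : 'I_k -> U -> R) : \bar R :=
  \sum_(1 <= a < m.+1) weights_cost (Q a) F w.

Definition parity (w : 'I_k -> U -> R) : Prop := forall i a a', Aset m a -> Aset m a' ->
  \int[Q a]_u (w i u)%:E = \int[Q a']_u (w i u)%:E.

Let dens := @slice_density _ X R k mu.

Let idens a : Aset m a -> nu.-integrable setT (EFin \o dens a).
Proof.
move=> Aa; apply: measurable_bounded_integrable => //.
- by rewrite ltey_eq fin_num_measure.
- exact: measurable_slice_density.
- exists (`|(fine (probA mu a))^-1|)%R; split; first exact: num_real.
  move=> M ltM u _; apply: le_trans (ltW ltM).
  rewrite normrM ler_piMl// indicE; by case: (_ \in _); rewrite ?normr1 ?normr0.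
Qed.

(** All group laws have densities with respect to the single probability [nu], so total cost and
    parity become pairings over [nu] and [weights_lp] applies. *)
Lemma optimal_weights (i0 : 'I_k) :
  exists w : 'I_k -> U -> R, [/\ weights w, parity w &
    forall w', weights w' -> parity w' -> total_cost w <= total_cost w'].
Proof.
have mF := measurable_regressor bf.
have ml i : measurable_fun setT (fun u => l1dist (F u) (onehot R i)).
  by apply: measurable_l1dist => //; exact: mF.
pose c i u : R := (l1dist (F u) (onehot R i) * \sum_(1 <= a < m.+1) dens a u)%R.
have dens0 a u : (0 <= dens a u)%R by exact: slice_density_ge0.
have c0 i u : (0 <= c i u)%R by rewrite mulr_ge0 ?l1dist_ge0// sumr_ge0.
have cE i u : c i u = (\sum_(1 <= a < m.+1) l1dist (F u) (onehot R i) * dens a u)%R.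
  by rewrite /c mulr_sumr.
have ic : integrables nu c.
  move=> i; rewrite (_ : _ \o _ = fun u => \sum_(1 <= a < m.+1 | (1 <= a < m.+1)%N)
      (EFin \o (fun u => l1dist (F u) (onehot R i) * dens a u)%R) u); last first.
    apply/funext => u; rewrite /= cE -sumEFin [LHS]big_nat_cond.
    by apply: eq_bigl => a; rewrite andbT.
  apply: integrable_sum => // a Aa.
  exact: (integrable_l1dist_density cmu bf).
have costE w : weights w -> (pairing nu c w)%:E = total_cost w.
  move=> ww; have [mw w0 w1] := ww.
  have ipc := integrable_pairing ww ic.
  rewrite fineK; last exact: integrable_fin_num ipc.
  pose t a u : \bar R := ((\sum_i w i u * l1dist (F u) (onehot R i)) * dens a u)%:E.
  have mt a : measurable_fun setT (t a).
    apply/measurable_EFinP; apply: measurable_funM; last exact: measurable_slice_density.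
    by apply: measurable_sum => i; exact: measurable_funM.
  have t0 a u : 0 <= t a u.
    rewrite lee_fin mulr_ge0// sumr_ge0// => i _.
    by rewrite mulr_ge0// l1dist_ge0.
  transitivity (\int[nu]_u \sum_(1 <= a < m.+1) t a u).
    apply: eq_integral => u _; rewrite /t sumEFin -mulr_sumr mulr_suml.
    by congr EFin; apply: eq_bigr => i _; rewrite /c mulrA.
  rewrite ge0_integral_sum//; apply: eq_big_nat => a Aa.
  rewrite /weights_cost (integral_conditional cmu QE)//.
  - by apply: measurable_sum => i; exact: measurable_funM.
  - by move=> u; apply: sumr_ge0 => i _; rewrite mulr_ge0// l1dist_ge0.
pose e a (i : 'I_k) (w : 'I_k -> U -> R) : R := (\int[nu]_u (w i u * dens a u))%R.
(* Pairing with [g a a' i] gives the difference of the masses of label [i] in groups [a] and [a'];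
   parity asks that all these vanish. *)
pose g a a' i : 'I_k -> U -> R := fun j u => ((j == i)%:R * (dens a u - dens a' u))%R.
have iwd (w : 'I_k -> U -> R) i a : weights w -> Aset m a ->
    nu.-integrable setT (EFin \o (fun u => w i u * dens a u)%R).
  move=> ww Aa; exact: (integrable_weight_mul (g := fun=> dens a) i ww (fun=> idens Aa)).
have eE w i a : weights w -> Aset m a -> (e a i w)%:E = \int[Q a]_u (w i u)%:E.
  move=> ww Aa; have [mw w0 w1] := ww.
  rewrite (integral_conditional cmu QE)// fineK//.
  exact: integrable_fin_num (iwd w i a ww Aa).
have gE w i a a' : weights w -> Aset m a -> Aset m a' ->
    pairing nu (g a a' i) w = (e a i w - e a' i w)%R.
  move=> ww Aa Aa'; rewrite /e -RintegralB//; try exact: iwd.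
  apply: eq_Rintegral => u _; rewrite (bigD1 i)//= /g eqxx mul1r big1 ?addr0 ?mulrBr//.
  by move=> j /negbTE ->; rewrite mul0r mulr0.
pose C := [set gb | exists i a a', [/\ Aset m a, Aset m a' & gb = (g a a' i, 0%R : R)]].
have parityE w : weights w ->
    (parity w <-> forall gb, C gb -> pairing nu gb.1 w = gb.2).
  move=> ww; split=> [pw _ [i [a [a' [Aa Aa' ->]]]] /=|Cw i a a' Aa Aa'].
    rewrite gE//; apply/eqP; rewrite subr_eq0; apply/eqP/EFin_inj.
    by rewrite !eE//; exact: pw.
  rewrite -!eE//; congr EFin; apply/eqP; rewrite -subr_eq0 -gE//.
  by apply/eqP; apply: (Cw (_, _)); exists i, a, a'.
have [||w [ww Cw wmin]] := @weights_lp _ _ _ _ nu c C ic c0.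
- move=> _ [i [a [a' [Aa Aa' ->]]]] j /=.
  apply: (integrableZ_EFin (j == i)%:R).
  exact: (integrableB _ (idens Aa) (idens Aa')).
(* Always answering [i0] satisfies parity, so the program is feasible. *)
- pose w0 : 'I_k -> U -> R := fun i _ => (i == i0)%:R.
  have ww0 : weights w0.
    split=> [i|i u|u]; [exact: measurable_cst|exact: ler0n|].
    by rewrite (bigD1 i0)//= /w0 eqxx big1 ?addr0// => i /negbTE ->.
  exists w0 => //; apply/parityE => // i a a' _ _.
  have w0E b : \int[Q b]_u (w0 i u)%:E = ((i == i0)%:R)%:E.
    rewrite [LHS](integral_cst (Q b) measurableT (i == i0)%:R%:E).
    by rewrite [X in _ * X](probability_setT (Q b)) mule1.
  by rewrite !w0E.
exists w; split=> //; first exact/parityE.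
move=> w' ww' pw'; rewrite -!costE// lee_fin; apply: wmin => //.
exact/parityE.
Qed.

End optimal_weights.

(** * Equality of the classification and transport minima *)

Theorem theorem3p1 (R : realType) (d : measure_display) (X : measurableType d)
    (k m : nat) (mu : probability (X * k.-tuple R * nat)%type R)
    (f : X -> nat -> k.-tuple R) :
  standard_borel R X ->
  (2 <= k)%N ->
  classification_problem m mu ->
  bayes_regressor mu f ->
  (* the minimum over DP classifiers exists and equals the transport value *)
  (exists h : R.-pker (X * nat)%type ~> k.-tuple R,
     [/\ classifier h, DP m mu h,
         (forall h' : R.-pker (X * nat)%type ~> k.-tuple R,
            classifier h' -> DP m mu h' -> sumErr m mu h <= sumErr m mu h') &
         exists q : probability (k.-tuple R) R,
           [/\ in_Qk q,
               (forall q' : probability (k.-tuple R) R, in_Qk q' ->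
                  \sum_(1 <= a < m.+1) W1 (rstar mu f a) q
                  <= \sum_(1 <= a < m.+1) W1 (rstar mu f a) q') &
               sumErr m mu h
               = (2^-1)%:E * \sum_(1 <= a < m.+1) W1 (rstar mu f a) q]]) /\
  (* each W1 is a minimum over couplings (the inner minima exist) *)
  (forall q : probability (k.-tuple R) R, in_Qk q ->
   forall a, Aset m a ->
     exists g : probability (k.-tuple R * k.-tuple R)%type R,
       coupling (rstar mu f a) q g /\
       transport_cost g = W1 (rstar mu f a) q).
Proof.
move=> _ k2 cmu bf.
have i0 : 'I_k := Ordinal (ltnW k2).
have mF := measurable_regressor bf.
have /choice[Q QE] : forall a, exists Q : probability (X * nat)%type R, Aset m a ->
    forall g : X * nat -> \bar R, measurable_fun setT g -> (forall u, 0 <= g u) ->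
    \int[Q]_u g u = (\int[mu]_(z in [set z | z.2 = a]) g (projXA z)) *
      ((fine (probA mu a))^-1)%:E.
  move=> a; have [Aa|nAa] := pselect (Aset m a); last by exists (lawXA mu).
  by have [Q QE] := conditional_law cmu Aa; exists Q.
have rE := rstarE bf QE.
have optimal q : in_Qk q -> forall a, Aset m a ->
    exists2 g, coupling (rstar mu f a) q g & transport_cost g = W1 (rstar mu f a) q.
  move=> qY a Aa; apply: (@optimal_coupling _ _ _ _ (Q a) _ mF _ _ i0) => //.
  - by move=> i; exact: (integrable_l1dist_slice cmu bf QE).
  - by move=> B mB; exact: rE.
split; last first.
  by move=> q qY a Aa; have [g gc gW] := optimal q qY a Aa; exists g.
(* [mu] gives mass 1 to groups in [[m]], so [m] is positive and group 1 can serve as reference. *)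
have A1 : Aset m 1%N.
  rewrite /Aset/= lt0n; apply/eqP => m0.
  have := cmu.1; rewrite (_ : _ `*` _ = set0) ?measure0.
    by move=> /eqP; rewrite eq_sym onee_eq0.
  by apply/seteqP; split=> // z [_ /= /andP[]]; rewrite m0 => /leq_trans/[apply].
have [w [ww pw wmin]] := optimal_weights cmu bf QE i0.
have sumE (h : R.-pker (X * nat)%type ~> k.-tuple R) (v : 'I_k -> X * nat -> R) :
    weights v -> (forall u B, measurable B ->
    h u B = \sum_i (v i u)%:E * \d_(onehot R i) B) ->
    sumErr m mu h = (2^-1)%:E * total_cost m f Q v.
  move=> wv hv; rewrite /sumErr /total_cost ge0_sume_distrr.
    by apply: eq_big_nat => a Aa; exact: (Err_weights cmu bf QE wv hv).
  move=> a _; apply: integral_ge0 => u _; rewrite lee_fin sumr_ge0// => i _.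
  by have [_ v0 _] := wv; rewrite mulr_ge0// l1dist_ge0.
pose h : R.-pker (X * nat)%type ~> k.-tuple R :=
  mixture ww (fun i => measurable_cst (onehot R i)).
have hw u B : measurable B -> h u B = \sum_i (w i u)%:E * \d_(onehot R i) B.
  by move=> _; exact: mixtureE.
have [_ w0 w1] := ww.
have hY : classifier h.
  move=> u; rewrite hw; last exact: measurable_Yset.
  rewrite -[RHS]/((1%R : R)%:E) -(w1 u) -sumEFin; apply: eq_bigr => i _.
  by rewrite diracE mem_set ?mule1//; exists i.
have hDP : DP m mu h.
  move=> _ [i ->] a a' Aa Aa'.
  rewrite (prob_pred_weights QE ww hw)// (prob_pred_weights QE ww hw)//.
  exact: pw.
(* [q] is the output law of the optimal classifier in group 1, and by parity in every group. *)
have [q qE] := mixture_law (Q 1%N) ww (fun i => measurable_cst (onehot R i)).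
have qB B : measurable B -> q B = \int[Q 1%N]_u \sum_i (w i u)%:E * \d_(onehot R i) B.
  move=> mB; have -> : q B = \int[q]_z (\1_B z)%:E by rewrite integral_indic// setIT.
  by rewrite qE//; exact/measurable_EFinP.
have qY : in_Qk q.
  rewrite /in_Qk qB; last exact: measurable_Yset.
  rewrite -(probability_setT (Q 1%N)) -[RHS]mul1e -integral_cst//.
  by apply: eq_integral => u _; rewrite -hw ?hY//; exact: measurable_Yset.
have qw i : q [set onehot R i] = \int[Q 1%N]_u (w i u)%:E.
  rewrite qB; last exact: measurable_tuple1.
  by apply: eq_integral => u _; rewrite sum_dirac_onehot.
(* Optimal couplings of each [r*_a] with the same [q'] give weights which, glued over the groups,
   satisfy parity; [wmin] compares [w] with them. *)
have lower q' : in_Qk q' ->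
    total_cost m f Q w <= \sum_(1 <= a < m.+1) W1 (rstar mu f a) q'.
  move=> q'Y.
  (* For indices outside [[m]] the family [w] is the default. *)
  have /choice[V VP] : forall a, exists v : 'I_k -> X * nat -> R, weights v /\
      (Aset m a -> (forall i, \int[Q a]_u (v i u)%:E = q' [set onehot R i]) /\
        weights_cost (Q a) (fun u => f u.1 u.2) v = W1 (rstar mu f a) q').
    move=> a; have [Aa|nAa] := pselect (Aset m a); last by exists w.
    have [g gc gW] := optimal q' q'Y a Aa.
    have [v [wv vq vc]] := weights_of_coupling mF i0 (fun B mB => rE a B Aa mB) q'Y gc.
    exists (fun i u => v i (f u.1 u.2)); split; last by rewrite vc gW.
    have [mv v0 v1] := wv; split=> // i; exact: measurableT_comp.
  have wV a : weights (V a) by have [] := VP a.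
  have wG := weights_glue wV.
  have gluei a i : Aset m a ->
      \int[Q a]_u (V u.2 i u)%:E = \int[Q a]_u (V a i u)%:E.
    have [mG G0 _] := wG; have [mV V0 _] := wV a => Aa.
    by apply: (eq_integral_conditional QE Aa) => // u ->.
  have pG : parity m Q (fun i u => V u.2 i u).
    move=> i a a' Aa Aa'; rewrite !gluei//.
    by rewrite ((VP a).2 Aa).1 ((VP a').2 Aa').1.
  apply: le_trans (wmin _ wG pG) _.
  rewrite le_eqVlt; apply/orP; left; apply/eqP.
  apply: eq_big_nat => a Aa; rewrite -((VP a).2 Aa).2.
  have cost_meas v : weights v -> measurable_fun setT
      (fun u => \sum_i v i u * l1dist (f u.1 u.2) (onehot R i))%R.
    move=> [mv _ _]; apply: measurable_sum => i; apply: measurable_funM => //.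
    exact: measurable_l1dist.
  have cost_ge0 v : weights v ->
      (forall u, 0 <= \sum_i v i u * l1dist (f u.1 u.2) (onehot R i))%R.
    move=> [_ v0 _] u; apply: sumr_ge0 => i _.
    by rewrite mulr_ge0// l1dist_ge0.
  apply: (eq_integral_conditional QE Aa).
  - exact: (cost_meas _ wG).
  - exact: (cost_meas _ (wV a)).
  - exact: (cost_ge0 _ wG).
  - exact: (cost_ge0 _ (wV a)).
  - by move=> u ->.
(* In each group [w] induces a coupling of [r*_a] with the common law [q], at the cost of [w]
   there. *)
have upper : \sum_(1 <= a < m.+1) W1 (rstar mu f a) q <= total_cost m f Q w.
  rewrite /total_cost big_nat_cond [leRHS]big_nat_cond; apply: lee_sum => a /andP[Aa _].
  have [|g gc <-] := coupling_of_weights mF (fun B mB => rE a B Aa mB) qY ww.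
    by move=> i; rewrite qw; exact: pw.
  by apply: ereal_inf_lbound; exists g.
exists h; split=> //.
  move=> h' h'Y h'DP.
  have [w' ww' hw'] := classifier_weightsE h'Y.
  rewrite (sumE _ _ ww hw) (sumE _ _ ww' hw').
  apply: lee_wpmul2l; first by rewrite lee_fin invr_ge0.
  apply: wmin => // i a a' Aa Aa'.
  rewrite -(prob_pred_weights QE ww' hw')// -(prob_pred_weights QE ww' hw')//.
  by apply: h'DP => //; exists i.
exists q; split=> //.
  (* The optimal cost of weights lies above the value at [q] and below the value at every [q'], so
     [q] is optimal. *)
  by move=> q' q'Y; apply: le_trans upper (lower q' q'Y).
rewrite (sumE _ _ ww hw); congr (_ * _); apply/eqP.
by rewrite eq_le upper lower.
Qed.
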